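(* Let $G$ be a cograph. Then the following are equivalent: (1) $G$ does not have quantum symmetry; (2) $G$ does not satisfy Schmidt's criterion; (3) $G=K_1$ or, letting $n=\#V(G)$, we have $G\in\{X_n,X_n^c,Y_n,Y_n^c\}$.
   Context: Graphs are finite, simple and undirected, with at least one vertex, and considered up to isomorphism. $G+H$ is the disjoint union, $G^c$ the complement of $G$, $K_m$ the complete graph on $m$ vertices. The class of cographs is the smallest class of graphs containing $K_1$ and stable under finite disjoint unions and complement. For a graph $L$, define inductively $Z_1(L)=L$ and $Z_{n+1}(L)=K_1+Z_n(L)^c$ for $n\ge 1$. Set $X_n=Z_n(K_1)$ and $Y_{n+1}=Z_n(K_2)$ for $n\ge1$ (so $X_n$ is defined for $n\ge 1$, $Y_n$ for $n\ge 2$, and both have $n$ vertices). A graph satisfies Schmidt's criterion if it has two nontrivial automorphisms $f,g$ with disjoint supports, where $\mathrm{Supp}(f)=\{x\in V(G)\mid f(x)\ne x\}$. $C(\mathrm{Qu}(G))$ is the universal unital $C^*$-algebra generated by elements $u_{xy}$ ($x,y\in V(G)$) that are self-adjoint projections with $\sum_y u_{xy}=1=\sum_y u_{yx}$ for all $x$ and such that $u=(u_{xy})$ commutes with the adjacency matrix of $G$; $G$ has quantum symmetry if $C(\mathrm{Qu}(G))$ is not commutative. *)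

(* Defs.v *)
From HB Require Import structures.
From mathcomp Require Import all_boot all_order all_algebra all_fingroup complex.
From mathcomp Require Import all_classical all_reals topology normedtype.

Set Implicit Arguments.
Unset Strict Implicit.
Unset Printing Implicit Defensive.

Import Order.TTheory GRing.Theory Num.Theory numFieldNormedType.Exports.

Local Open Scope ring_scope.

Record sgraph := SGraph {
  vertex :> finType;
  edge : rel vertex;
  edge_sym : symmetric edge;
  edge_irrefl : irreflexive edge;
  vertex_gt0 : (0 < #|vertex|)%N }.

Definition isomorphic (G H : sgraph) : Prop :=
  exists2 f : G -> H, bijective f & {mono f : x y / edge x y}.

Definition automorphism (G : sgraph) (f : {perm G}) : Prop :=
  {mono f : x y / edge x y}.

Section GraphOperations.
Variables G H : sgraph.

Definition compl_edge : rel G := [rel x y | (x != y) && ~~ edge x y].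

Lemma compl_edge_sym : symmetric compl_edge.
Proof. by move=> x y; rewrite /compl_edge/= eq_sym edge_sym. Qed.

Lemma compl_edge_irrefl : irreflexive compl_edge.
Proof. by move=> x; rewrite /compl_edge/= eqxx. Qed.

Definition complement : sgraph :=
  SGraph compl_edge_sym compl_edge_irrefl (vertex_gt0 G).

Definition union_edge : rel (G + H)%type := fun x y =>
  match x, y with
  | inl x, inl y => edge x y
  | inr x, inr y => edge x y
  | _, _ => false
  end.

Lemma union_edge_sym : symmetric union_edge.
Proof. by move=> [x|x] [y|y] //=; exact: edge_sym. Qed.

Lemma union_edge_irrefl : irreflexive union_edge.
Proof. by move=> [x|x] /=; exact: edge_irrefl. Qed.

Lemma union_gt0 : (0 < #|{: G + H}|)%N.
Proof. by rewrite card_sum addn_gt0 vertex_gt0. Qed.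

Definition disjoint_union : sgraph :=
  SGraph union_edge_sym union_edge_irrefl union_gt0.

End GraphOperations.

Section CompleteGraph.
Variables (m : nat) (m_gt0 : (0 < m)%N).

Definition complete_edge : rel 'I_m := [rel x y | x != y].

Lemma complete_edge_sym : symmetric complete_edge.
Proof. by move=> x y; rewrite /complete_edge/= eq_sym. Qed.

Lemma complete_edge_irrefl : irreflexive complete_edge.
Proof. by move=> x; rewrite /complete_edge/= eqxx. Qed.

Lemma complete_gt0 : (0 < #|'I_m|)%N.
Proof. by rewrite card_ord. Qed.

Definition complete_graph : sgraph :=
  SGraph complete_edge_sym complete_edge_irrefl complete_gt0.

End CompleteGraph.

Definition K1 : sgraph := @complete_graph 1 isT.
Definition K2 : sgraph := @complete_graph 2 isT.

Inductive cograph : sgraph -> Prop :=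
| cograph_K1 : cograph K1
| cograph_union G H : cograph G -> cograph H -> cograph (disjoint_union G H)
| cograph_complement G : cograph G -> cograph (complement G)
| cograph_iso G H : isomorphic G H -> cograph G -> cograph H.

(* [Z_graph 0 L] is a dummy value: the sequence starts at [Z_graph 1 L = L]. *)
Definition Z_graph (n : nat) (L : sgraph) : sgraph :=
  iter n.-1 (fun H => disjoint_union K1 (complement H)) L.

Definition X_graph (n : nat) : sgraph := Z_graph n K1.

(* Meaningful only for [2 <= n]. *)
Definition Y_graph (n : nat) : sgraph := Z_graph n.-1 K2.

Definition Supp (G : sgraph) (f : {perm G}) : {set G} :=
  [set x | f x != x].

Definition schmidt_criterion (G : sgraph) : Prop :=
  exists f g : {perm G},
    [/\ automorphism f, automorphism g, f != 1%g, g != 1%g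
      & [disjoint Supp f & Supp g]].

Local Open Scope classical_set_scope.

(* C*-algebras are unital here, and the zero algebra is one. In MathComp the
   join of rings with normed modules is already [numDomainType], so a join of
   [completeNormedModType] with [algType] cannot be declared: the mixin carries
   the product and the unit, and the ring structure (hence [*] and [1]) is
   derived from it below. The genuine notion is the case [C := R[i]] with
   [R : realType]. *)
HB.mixin Record isCStarAlgebra (C : numClosedFieldType) A
    & CompleteNormedModule C A := {
  cmul : A -> A -> A;
  cone : A;
  star : A -> A;
  cmulA : associative cmul;
  cmul1l : left_id cone cmul;
  cmul1r : right_id cone cmul;
  cmulDl : left_distributive cmul +%R;
  cmulDr : right_distributive cmul +%R;
  cscaleAl : forall (c : C) x y, c *: cmul x y = cmul (c *: x) y;
  cscaleAr : forall (c : C) x y, c *: cmul x y = cmul x (c *: y);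
  starD : forall x y, star (x + y) = star x + star y;
  starZ : forall (c : C) x, star (c *: x) = c^* *: star x;
  cstarM : forall x y, star (cmul x y) = cmul (star y) (star x);
  starK : involutive star;
  cnormM_le : forall x y, `|cmul x y| <= `|x| * `|y|;
  cnorm_starM : forall x, `|cmul (star x) x| = `|x| ^+ 2
}.

#[short(type="cstarType")]
HB.structure Definition CStarAlgebra (C : numClosedFieldType) :=
  {A of CompleteNormedModule C A & isCStarAlgebra C A}.

#[warnings="-redundant-canonical-projection"]
HB.instance Definition _ (C : numClosedFieldType) (A : cstarType C) :=
  GRing.Zmodule_isPzRing.Build (CStarAlgebra.sort A)
    (@cmulA C A) (@cmul1l C A) (@cmul1r C A) (@cmulDl C A) (@cmulDr C A).

Definition commutative_cstar (C : numClosedFieldType) (A : cstarType C) : Prop :=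
  forall a b : A, a * b = b * a.

Definition star_morphism (C : numClosedFieldType) (A B : cstarType C)
    (phi : A -> B) : Prop :=
  [/\ forall a b, phi (a + b) = phi a + phi b,
      forall (c : C) a, phi (c *: a) = c *: phi a,
      forall a b, phi (a * b) = phi a * phi b,
      phi 1 = 1
    & forall a, phi (star a) = star (phi a)].

Definition generated_by (C : numClosedFieldType) (A : cstarType C) (I : Type)
    (u : I -> I -> A) : Prop :=
  forall S : set A,
    closed S -> (forall i j, S (u i j)) -> S 1 ->
    (forall a b, S a -> S b -> S (a + b)) ->
    (forall (c : C) a, S a -> S (c *: a)) ->
    (forall a b, S a -> S b -> S (a * b)) ->
    (forall a, S a -> S (star a)) ->
  S = setT.

(* The last relation is entry (x, y) of [u] times the adjacency matrix equals
   the adjacency matrix times [u]. *)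
Definition quantum_automorphism (C : numClosedFieldType) (G : sgraph)
    (A : cstarType C) (u : G -> G -> A) : Prop :=
  [/\ forall x y, star (u x y) = u x y /\ u x y * u x y = u x y,
      forall x, \sum_(y : G) u x y = 1,
      forall x, \sum_(y : G) u y x = 1
    & forall x y, \sum_(z : G) u x z * (edge z y)%:R
                = \sum_(z : G) (edge x z)%:R * u z y].

Definition universal_quantum_automorphism (C : numClosedFieldType) (G : sgraph)
    (A : cstarType C) (u : G -> G -> A) : Prop :=
  [/\ quantum_automorphism u,
      generated_by u
    & forall (B : cstarType C) (v : G -> G -> B), quantum_automorphism v ->
      exists2 phi : A -> B, star_morphism phi & forall x y, phi (u x y) = v x y].

Section CStarFacts.
Variables (C : numClosedFieldType) (A : cstarType C).
Implicit Types x y p : A.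

Lemma starM x y : star (x * y) = star y * star x.
Proof. exact: cstarM. Qed.

Lemma normM_le x y : `|x * y| <= `|x| * `|y|.
Proof. exact: cnormM_le. Qed.

Lemma norm_starM x : `|star x * x| = `|x| ^+ 2.
Proof. exact: cnorm_starM. Qed.

Lemma star1 : star 1 = 1 :> A.
Proof. by rewrite -[LHS]mulr1 -{2}[1]starK -starM mulr1 starK. Qed.

Lemma norm_star_le x : `|x| <= `|star x|.
Proof.
have [->|x0] := eqVneq x 0; first by rewrite normr0.
have xp : 0 < `|x| by rewrite normr_gt0.
by rewrite -(ler_pM2r xp) -expr2 -norm_starM normM_le.
Qed.

Lemma norm_star x : `|star x| = `|x|.
Proof.
by apply/eqP; rewrite eq_le norm_star_le -{2}[x]starK norm_star_le.
Qed.

Lemma norm_projection p : star p = p -> p * p = p -> `|p| <= 1.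
Proof.
move=> ps pp; have := norm_starM p; rewrite ps pp => E.
have [->|p0] := eqVneq p 0; first by rewrite normr0.
have np : `|p| != 0 by rewrite normr_eq0.
suff -> : `|p| = 1 by [].
by apply: (mulfI np); rewrite mulr1 -expr2 -E.
Qed.

End CStarFacts.

Section Existence.
Variables (R : realType) (G : sgraph).
Local Notation C := R[i].

Record model := Model {
  model_alg :> cstarType C;
  model_mx : G -> G -> model_alg;
  modelP : quantum_automorphism model_mx }.

Inductive term :=
| tgen of G & G
| tcst of C
| tadd of term & term
| tmul of term & term.

Fixpoint ev (M : model) (t : term) : M :=
  match t with
  | tgen x y => model_mx M x y
  | tcst c => c *: (1 : M)
  | tadd s t => ev M s + ev M t
  | tmul s t => ev M s * ev M t
  end.

Fixpoint tstar (t : term) : term :=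
  match t with
  | tgen x y => tgen x y
  | tcst c => tcst c^*
  | tadd s t => tadd (tstar s) (tstar t)
  | tmul s t => tmul (tstar t) (tstar s)
  end.

Lemma ev_star M t : ev M (tstar t) = star (ev M t).
Proof.
elim: t => /= [x y|c|s -> t ->|s -> t ->].
- by have [/(_ x y)[-> _] _ _ _] := modelP M.
- by rewrite starZ star1.
- by rewrite starD.
- by rewrite starM.
Qed.

Lemma norm1_le (M : model) : `|1 : M| <= 1.
Proof. by apply: norm_projection; rewrite ?star1 ?mulr1. Qed.

Lemma ev_bound t : exists2 K : C, 0 <= K & forall M, `|ev M t| <= K.
Proof.
elim: t => /= [x y|c|s [K K0 HK] t [L L0 HL]|s [K K0 HK] t [L L0 HL]].
- exists 1 => // M; have [/(_ x y)[su uu] _ _ _] := modelP M.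
  exact: norm_projection.
- exists `|c| => // M; rewrite normrZ ler_piMr //; exact: norm1_le.
- exists (K + L); first exact: addr_ge0.
  by move=> M; rewrite (le_trans (ler_normD _ _)) // lerD.
- exists (K * L); first exact: mulr_ge0.
  by move=> M; rewrite (le_trans (normM_le _ _)) // ler_pM.
Qed.

Definition family := forall M : model, M.

Definition rep (f : family) : Prop :=
  forall e : C, 0 < e -> exists t, forall M, `|f M - ev M t| <= e.

Lemma rep_bound f : rep f -> exists2 K : C, 0 <= K & forall M, `|f M| <= K.
Proof.
move=> /(_ 1 ltr01)[t ft]; have [K K0 HK] := ev_bound t.
exists (1 + K); first exact: addr_ge0.
by move=> M; rewrite -[f M](subrK (ev M t)) (le_trans (ler_normD _ _)) // lerD.
Qed.

Lemma rep_ev t : rep (fun M => ev M t).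
Proof. by move=> e e0; exists t => M; rewrite subrr normr0 ltW. Qed.

Lemma rep_add f g : rep f -> rep g -> rep (fun M => f M + g M).
Proof.
move=> rf rg e e0; have e2 : 0 < e / 2 by rewrite divr_gt0.
have [s fs] := rf _ e2; have [t gt] := rg _ e2.
exists (tadd s t) => M /=; rewrite opprD addrACA (le_trans (ler_normD _ _)) //.
by rewrite [leRHS]splitr lerD.
Qed.

Lemma rep_scale (c : C) f : rep f -> rep (fun M => c *: f M).
Proof.
move=> rf e e0; have c0 : 0 < `|c| + 1 by rewrite ltr_wpDl.
have [s fs] := rf (e / (`|c| + 1)) (divr_gt0 e0 c0).
exists (tmul (tcst c) s) => M /=.
rewrite -[X in _ - X]cscaleAl [cmul 1 _]mul1r -scalerBr normrZ.
rewrite (@le_trans _ _ ((`|c| + 1) * `|f M - ev M s|)) //.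
  by rewrite ler_wpM2r // lerDl.
by rewrite mulrC -ler_pdivlMr.
Qed.

Lemma rep_star f : rep f -> rep (fun M => star (f M)).
Proof.
move=> rf e e0; have [t ft] := rf e e0; exists (tstar t) => M.
by rewrite ev_star -scaleN1r -[-1]conjCK -starZ -starD norm_star rmorphN1 scaleN1r.
Qed.

Lemma rep_mul f g : rep f -> rep g -> rep (fun M => f M * g M).
Proof.
move=> rf rg e e0; have [K K0 HK] := rep_bound rf.
have Kp : 0 < K + 1 by rewrite ltr_wpDl.
have e2 : 0 < e / 2 by rewrite divr_gt0.
have [t gt] := rg (e / 2 / (K + 1)) (divr_gt0 e2 Kp).
have [L L0 HL] := ev_bound t.
have Lp : 0 < L + 1 by rewrite ltr_wpDl.
have [s fs] := rf (e / 2 / (L + 1)) (divr_gt0 e2 Lp).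
exists (tmul s t) => M /=.
have -> : f M * g M - ev M s * ev M t
        = f M * (g M - ev M t) + (f M - ev M s) * ev M t.
  by rewrite mulrBr mulrBl addrA subrK.
rewrite (le_trans (ler_normD _ _)) // [leRHS]splitr lerD //.
- rewrite (le_trans (normM_le _ _)) //.
  rewrite (@le_trans _ _ ((K + 1) * `|g M - ev M t|)) //.
    by rewrite ler_wpM2r // (le_trans (HK M)) // lerDl.
  by rewrite mulrC -ler_pdivlMr.
- rewrite (le_trans (normM_le _ _)) //.
  rewrite (@le_trans _ _ (`|f M - ev M s| * (L + 1))) //.
    by rewrite ler_wpM2l // (le_trans (HL M)) // lerDl.
  by rewrite -ler_pdivlMr.
Qed.

Definition approx (f : family) : set (C * term) :=
  [set et | forall M, `|f M - ev M et.2| <= et.1].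

Lemma small_eq0 (M : model) (x : M) : (forall e : C, 0 < e -> `|x| <= e) -> x = 0.
Proof.
move=> h; apply/eqP; rewrite -normr_eq0 eq_le normr_ge0 andbT.
have [->|x0] := eqVneq x 0; first by rewrite normr0.
have xp : 0 < `|x| by rewrite normr_gt0.
have := h (`|x| / 2); rewrite divr_gt0 // => /(_ isT).
rewrite {1}[`|x|]splitr gerDl => h2.
by have := lt_le_trans (divr_gt0 xp (ltr0n _ 2)) h2; rewrite ltxx.
Qed.

Lemma approx_inj f g : rep f -> approx f = approx g -> f = g.
Proof.
move=> rf fg; apply: functional_extensionality_dep => M.
apply/eqP; rewrite -subr_eq0; apply/eqP; apply: small_eq0 => e e0.
have e2 : 0 < e / 2 by rewrite divr_gt0.
have [t ft] := rf _ e2.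
have : approx g (e / 2, t) by rewrite -fg.
move=> /(_ M)/= gt.
rewrite -(subrKA (ev M t)) (le_trans (ler_normD _ _)) //.
by rewrite [leRHS]splitr lerD // distrC.
Qed.

(* An element of C(Qu(G)) is a family of elements of all models that is a
   uniform limit of *-polynomials in the generators. Storing the family itself
   would raise the universe level, so it is encoded by its approximants. *)
Definition cqu := {S : set (C * term) | exists2 f, rep f & S = approx f}.

HB.instance Definition _ := gen_eqMixin cqu.
HB.instance Definition _ := gen_choiceMixin cqu.

Definition val_cqu (a : cqu) : family := s2val (cid2 (svalP a)).

Lemma val_rep a : rep (val_cqu a).
Proof. by rewrite /val_cqu; case: cid2. Qed.

Definition mk_cqu f (rf : rep f) : cqu :=
  exist _ (approx f) (ex_intro2 _ _ f rf erefl).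

Lemma mk_cquK f (rf : rep f) : val_cqu (mk_cqu rf) = f.
Proof.
rewrite /val_cqu; case: cid2 => /= g rg E.
by symmetry; exact: approx_inj E.
Qed.

Lemma cqu_inj a b : (forall M, val_cqu a M = val_cqu b M) -> a = b.
Proof.
move=> ab; have {}ab : val_cqu a = val_cqu b by exact: functional_extensionality_dep.
have {ab} : sval a = sval b.
  by move: ab; rewrite /val_cqu; do 2 case: cid2 => /= ? _ -> /=; move=> ->.
by case: a b => [S p] [T q] /=; exact: eq_exist.
Qed.

Definition cqu_zero := mk_cqu (rep_ev (tcst 0)).
Definition cqu_one := mk_cqu (rep_ev (tcst 1)).
Definition cqu_add a b := mk_cqu (rep_add (val_rep a) (val_rep b)).
Definition cqu_scale c a := mk_cqu (rep_scale c (val_rep a)).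
Definition cqu_opp a := cqu_scale (-1) a.
Definition cqu_mul a b := mk_cqu (rep_mul (val_rep a) (val_rep b)).
Definition cqu_star a := mk_cqu (rep_star (val_rep a)).
Definition cqu_gen x y := mk_cqu (rep_ev (tgen x y)).

Lemma cqu_addA : associative cqu_add.
Proof. by move=> a b c; apply: cqu_inj => M; rewrite !mk_cquK addrA. Qed.
Lemma cqu_addC : commutative cqu_add.
Proof. by move=> a b; apply: cqu_inj => M; rewrite !mk_cquK addrC. Qed.
Lemma cqu_add0 : left_id cqu_zero cqu_add.
Proof. by move=> a; apply: cqu_inj => M; rewrite !mk_cquK /= scale0r add0r. Qed.
Lemma cqu_addN : left_inverse cqu_zero cqu_opp cqu_add.
Proof.
by move=> a; apply: cqu_inj => M; rewrite !mk_cquK /= scale0r scaleN1r addNr.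
Qed.
HB.instance Definition _ :=
  GRing.isZmodule.Build cqu cqu_addA cqu_addC cqu_add0 cqu_addN.

Lemma val_add a b M : val_cqu (a + b) M = val_cqu a M + val_cqu b M.
Proof. by rewrite [in LHS]mk_cquK. Qed.
Lemma val_opp a M : val_cqu (- a) M = - val_cqu a M.
Proof. by rewrite [in LHS]mk_cquK scaleN1r. Qed.
Lemma val_zero M : val_cqu 0 M = 0.
Proof. by rewrite [in LHS]mk_cquK /= scale0r. Qed.

Lemma cqu_scaleA c d a : cqu_scale c (cqu_scale d a) = cqu_scale (c * d) a.
Proof. by apply: cqu_inj => M; rewrite !mk_cquK scalerA. Qed.
Lemma cqu_scale1 : left_id 1 cqu_scale.
Proof. by move=> a; apply: cqu_inj => M; rewrite !mk_cquK scale1r. Qed.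
Lemma cqu_scaleDr : right_distributive cqu_scale +%R.
Proof.
by move=> c a b; apply: cqu_inj => M; rewrite !mk_cquK scalerDr.
Qed.
Lemma cqu_scaleDl a : {morph cqu_scale^~ a : c d / c + d}.
Proof.
by move=> c d; apply: cqu_inj => M; rewrite !mk_cquK scalerDl.
Qed.
HB.instance Definition _ := GRing.Zmodule_isLmodule.Build C cqu
  cqu_scaleA cqu_scale1 cqu_scaleDr cqu_scaleDl.

Lemma val_scale (c : C) (a : cqu) M : val_cqu (c *: a) M = c *: val_cqu a M.
Proof. by rewrite [in LHS]mk_cquK. Qed.

Definition cqu_norm (a : cqu) : C :=
  (sup [set r | exists M, r = complex.Re `|val_cqu a M|])%:C%C.

Lemma Re_le (x y : C) : x <= y -> complex.Re x <= complex.Re y.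
Proof. by case: x y => [a b] [c d]; rewrite lecE /= => /andP[]. Qed.

Lemma norm_Re (z : C) : 0 <= z -> z = (complex.Re z)%:C%C.
Proof. by move=> /ger0_real /RRe_real. Qed.

Lemma le_cqu_norm a M : `|val_cqu a M| <= cqu_norm a.
Proof.
rewrite [leLHS]norm_Re // lecR; apply: ub_le_sup; last by exists M.
have [K K0 HK] := rep_bound (val_rep a).
by exists (complex.Re K) => _ [N ->]; exact: Re_le.
Qed.

Lemma cqu_norm_ge0 a : 0 <= cqu_norm a.
Proof.
have [[M]|noM] := pselect (inhabited model).
  exact: le_trans (normr_ge0 _) (le_cqu_norm a M).
rewrite /cqu_norm (_ : mkset _ = set0) ?sup0 //.
by rewrite -subset0 => r [M _]; apply: noM.
Qed.

Lemma cqu_norm_le a (K : C) :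
  0 <= K -> (forall M, `|val_cqu a M| <= K) -> cqu_norm a <= K.
Proof.
move=> K0 HK; have [[M]|noM] := pselect (inhabited model); last first.
  rewrite /cqu_norm (_ : mkset _ = set0) ?sup0 //.
  by rewrite -subset0 => r [M _]; apply: noM.
rewrite [leRHS]norm_Re // lecR; apply: ge_sup; first by exists (complex.Re `|val_cqu a M|), M.
by move=> _ [N ->]; exact: Re_le.
Qed.

Lemma cqu_normD a b : cqu_norm (a + b) <= cqu_norm a + cqu_norm b.
Proof.
apply: cqu_norm_le => [|M]; first by rewrite addr_ge0 // cqu_norm_ge0.
by rewrite val_add (le_trans (ler_normD _ _)) // lerD // le_cqu_norm.
Qed.

Lemma cqu_normZ_le c a : cqu_norm (c *: a) <= `|c| * cqu_norm a.
Proof.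
apply: cqu_norm_le => [|M]; first by rewrite mulr_ge0 // cqu_norm_ge0.
by rewrite val_scale normrZ ler_wpM2l // le_cqu_norm.
Qed.

Lemma cqu_norm0_eq0 a : cqu_norm a = 0 -> a = 0.
Proof.
move=> a0; apply: cqu_inj => M; rewrite val_zero; apply/eqP.
by rewrite -normr_eq0 eq_le normr_ge0 andbT -a0 le_cqu_norm.
Qed.

Lemma cqu_normZ c a : cqu_norm (c *: a) = `|c| * cqu_norm a.
Proof.
apply/eqP; rewrite eq_le cqu_normZ_le /=.
have [->|c0] := eqVneq c 0; first by rewrite normr0 mul0r cqu_norm_ge0.
have cp : 0 < `|c| by rewrite normr_gt0.
have := cqu_normZ_le c^-1 (c *: a).
by rewrite scalerA mulVf // scale1r normfV ler_pdivlMl.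
Qed.

HB.instance Definition _ :=
  Lmodule_isNormed.Build C cqu cqu_normD cqu_normZ cqu_norm0_eq0.

Lemma le_norm (a : cqu) M : `|val_cqu a M| <= `|a|.
Proof. exact: le_cqu_norm. Qed.

Lemma norm_le (a : cqu) (K : C) :
  0 <= K -> (forall M, `|val_cqu a M| <= K) -> `|a| <= K.
Proof. exact: cqu_norm_le. Qed.

Lemma val_sub (a b : cqu) M : val_cqu (a - b) M = val_cqu a M - val_cqu b M.
Proof. by rewrite val_add val_opp. Qed.

Lemma thirds (e : C) : e / 3 + e / 3 + e / 3 = e.
Proof. by rewrite -mulr2n -mulrSr -[LHS]mulr_natr divfK // pnatr_eq0. Qed.

Lemma cqu_complete (F : set_system cqu) : ProperFilter F -> cauchy F -> cvg F.
Proof.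
move=> FF /cauchy_ballP cF.
have near_pt (e : C) : 0 < e -> exists a : cqu, F [set b | `|b - a| <= e].
  move=> e0; have /cauchyP/(_ e e0)[a Fa] : cauchy F by exact/cauchy_ballP.
  exists a; apply: filterS Fa => b; rewrite -ball_normE /= distrC; exact: ltW.
have cM M : cvg (val_cqu^~ M @ F).
  apply: cauchy_cvg; apply: cauchy_exP => e e0.
  have e2 : 0 < e / 2 by rewrite divr_gt0.
  have [a Fa] := near_pt _ e2; exists (val_cqu a M).
  change (F [set b | ball (val_cqu a M) e (val_cqu b M)]).
  apply: filterS Fa => b /= ab; rewrite -ball_normE /= distrC -val_sub.
  rewrite (le_lt_trans (le_norm _ _)) // (le_lt_trans ab) //.
  by rewrite ltr_pdivrMr // mulr_natr mulr2n ltrDl.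
pose f : family := fun M => lim (val_cqu^~ M @ F).
have close (e : C) (a : cqu) : 0 < e -> F [set b | `|b - a| <= e] ->
    forall M, `|f M - val_cqu a M| <= e + e.
  move=> e0 Fa M.
  have /cvgrPdist_le/(_ e e0) Fe := cM M.
  have [b [/= ab fb]] := filter_ex (filterI Fa Fe).
  rewrite -(subrKA (val_cqu b M)) (le_trans (ler_normD _ _)) // lerD //.
  by rewrite -(val_sub b a) (le_trans (le_norm _ _)).
have rf : rep f.
  move=> e e0; have e3 : 0 < e / 3 by rewrite divr_gt0.
  have [a Fa] := near_pt _ e3; have [t at_] := val_rep a e3.
  exists t => M; rewrite -(subrKA (val_cqu a M)) (le_trans (ler_normD _ _)) //.
  rewrite (@le_trans _ _ (e / 3 + e / 3 + e / 3)) //.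
    by rewrite lerD // close.
  by rewrite thirds.
apply/cvg_ex; exists (mk_cqu rf); apply/cvgrPdist_le => e e0.
have e3 : 0 < e / 3 by rewrite divr_gt0.
have [a Fa] := near_pt _ e3; apply: (filterS _ Fa) => b /= ab.
rewrite -(subrKA a) (le_trans (ler_normD _ _)) //.
rewrite (@le_trans _ _ (e / 3 + e / 3 + e / 3)) //; last first.
  by rewrite thirds.
rewrite lerD // 1?distrC //; apply: norm_le => [|M].
  by rewrite addr_ge0 // ltW.
by rewrite val_sub mk_cquK distrC close.
Qed.

HB.instance Definition _ := Uniform_isComplete.Build cqu cqu_complete.

Lemma cqu_mulA : associative cqu_mul.
Proof. by move=> a b c; apply: cqu_inj => M; rewrite !mk_cquK mulrA. Qed.
Lemma cqu_mul1l : left_id cqu_one cqu_mul.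
Proof. by move=> a; apply: cqu_inj => M; rewrite !mk_cquK /= scale1r mul1r. Qed.
Lemma cqu_mul1r : right_id cqu_one cqu_mul.
Proof. by move=> a; apply: cqu_inj => M; rewrite !mk_cquK /= scale1r mulr1. Qed.
Lemma cqu_mulDl : left_distributive cqu_mul +%R.
Proof. by move=> a b c; apply: cqu_inj => M; rewrite !mk_cquK mulrDl. Qed.
Lemma cqu_mulDr : right_distributive cqu_mul +%R.
Proof. by move=> a b c; apply: cqu_inj => M; rewrite !mk_cquK mulrDr. Qed.
Lemma cqu_scaleAl (c : C) a b : c *: cqu_mul a b = cqu_mul (c *: a) b.
Proof. by apply: cqu_inj => M; rewrite !mk_cquK [LHS]cscaleAl. Qed.
Lemma cqu_scaleAr (c : C) a b : c *: cqu_mul a b = cqu_mul a (c *: b).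
Proof. by apply: cqu_inj => M; rewrite !mk_cquK [LHS]cscaleAr. Qed.
Lemma cqu_starD a b : cqu_star (a + b) = cqu_star a + cqu_star b.
Proof. by apply: cqu_inj => M; rewrite !mk_cquK starD. Qed.
Lemma cqu_starZ (c : C) a : cqu_star (c *: a) = c^* *: cqu_star a.
Proof. by apply: cqu_inj => M; rewrite !mk_cquK starZ. Qed.
Lemma cqu_starM a b : cqu_star (cqu_mul a b) = cqu_mul (cqu_star b) (cqu_star a).
Proof. by apply: cqu_inj => M; rewrite !mk_cquK starM. Qed.
Lemma cqu_starK : involutive cqu_star.
Proof. by move=> a; apply: cqu_inj => M; rewrite !mk_cquK starK. Qed.

Lemma cqu_normM_le a b : `|cqu_mul a b| <= `|a| * `|b|.
Proof.
apply: norm_le => [|M]; first exact: mulr_ge0.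
by rewrite mk_cquK (le_trans (normM_le _ _)) // ler_pM // le_norm.
Qed.

Lemma cqu_norm_starM a : `|cqu_mul (cqu_star a) a| = `|a| ^+ 2.
Proof.
have le_sqrt (b : cqu) (K : C) : 0 <= K -> (forall M, `|val_cqu b M| ^+ 2 <= K) ->
    `|b| ^+ 2 <= K.
  move=> K0 HK; rewrite -[K]sqrtCK ler_pXn2r ?nnegrE ?sqrtC_ge0 //.
  apply: norm_le => [|M]; first by rewrite sqrtC_ge0.
  by rewrite -(@ler_pXn2r _ 2) ?nnegrE ?sqrtC_ge0 // sqrtCK.
apply/eqP; rewrite eq_le; apply/andP; split.
- apply: norm_le => [|M]; first exact: exprn_ge0.
  by rewrite !mk_cquK norm_starM ler_pXn2r ?nnegrE // le_norm.
- apply: le_sqrt => // M; rewrite -norm_starM.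
  by rewrite (le_trans _ (le_norm _ M)) // !mk_cquK.
Qed.

HB.instance Definition _ := isCStarAlgebra.Build C cqu
  cqu_mulA cqu_mul1l cqu_mul1r cqu_mulDl cqu_mulDr cqu_scaleAl cqu_scaleAr
  cqu_starD cqu_starZ cqu_starM cqu_starK cqu_normM_le cqu_norm_starM.

Local Notation A := (cqu : cstarType C).

Lemma val_mul (a b : A) M : val_cqu (a * b) M = val_cqu a M * val_cqu b M.
Proof. by rewrite [in LHS]mk_cquK. Qed.
Lemma val_one M : val_cqu (1 : A) M = 1.
Proof. by rewrite [in LHS]mk_cquK /= scale1r. Qed.
Lemma val_star (a : A) M : val_cqu (star a) M = star (val_cqu a M).
Proof. by rewrite [in LHS]mk_cquK. Qed.
Lemma val_sum (I : finType) (F : I -> A) M :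
  val_cqu (\sum_i F i) M = \sum_i val_cqu (F i) M.
Proof.
exact: (big_morph (fun a : A => val_cqu a M) (fun a b => val_add a b M) (val_zero M)).
Qed.
Lemma val_bool (b : bool) M : val_cqu (b%:R : A) M = b%:R.
Proof. by case: b; rewrite ?val_one ?val_zero. Qed.
Lemma val_gen x y M : val_cqu (cqu_gen x y) M = model_mx M x y.
Proof. by rewrite mk_cquK. Qed.

Lemma cqu_gen_quantum_automorphism :
  quantum_automorphism (cqu_gen : G -> G -> A).
Proof.
split=> [x y|x|x|x y].
- by split; apply: cqu_inj => M; have [/(_ x y)[su uu] _ _ _] := modelP M;
    rewrite ?val_star ?val_mul val_gen.
- apply: cqu_inj => M; have [_ h _ _] := modelP M.
  by rewrite val_sum val_one -(h x); apply: eq_bigr => z _; exact: val_gen.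
- apply: cqu_inj => M; have [_ _ h _] := modelP M.
  by rewrite val_sum val_one -(h x); apply: eq_bigr => z _; exact: val_gen.
- apply: cqu_inj => M; have [_ _ _ h] := modelP M.
  rewrite !val_sum; transitivity (\sum_(z : G) model_mx M x z * (edge z y)%:R).
    by apply: eq_bigr => z _; rewrite val_mul val_bool val_gen.
  by rewrite h; apply: eq_bigr => z _; rewrite val_mul val_bool val_gen.
Qed.

Lemma cqu_generated : generated_by (cqu_gen : G -> G -> A).
Proof.
move=> S cS Su S1 SD SZ SM Sst; apply/seteqP; split => // a _.
have Sev t : S (mk_cqu (rep_ev t)).
  elim: t => [x y|c|s Hs t Ht|s Hs t Ht].
  - exact: Su.
  - have -> : mk_cqu (rep_ev (tcst c)) = c *: (1 : A) by
      apply: cqu_inj => M; rewrite val_scale val_one mk_cquK.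
    exact: SZ.
  - have -> : mk_cqu (rep_ev (tadd s t)) = (mk_cqu (rep_ev s) : A) + mk_cqu (rep_ev t)
      by apply: cqu_inj => M; rewrite val_add !mk_cquK.
    exact: SD.
  - have -> : mk_cqu (rep_ev (tmul s t)) = (mk_cqu (rep_ev s) : A) * mk_cqu (rep_ev t)
      by apply: cqu_inj => M; rewrite val_mul !mk_cquK.
    exact: SM.
apply: cS => B /nbhs_ballP[e /= e0 Be].
have e2 : 0 < e / 2 by rewrite divr_gt0.
have [t at_] := val_rep a e2; exists (mk_cqu (rep_ev t)); split; first exact: Sev.
apply: Be; rewrite -ball_normE /=; apply: (@le_lt_trans _ _ (e / 2)); last first.
  by rewrite ltr_pdivrMr // mulr_natr mulr2n ltrDl.
by apply: norm_le => [|M]; [exact: ltW|rewrite val_sub mk_cquK].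
Qed.

Lemma cqu_universal :
  universal_quantum_automorphism (cqu_gen : G -> G -> A).
Proof.
split; [exact: cqu_gen_quantum_automorphism|exact: cqu_generated|move=> B v qv].
exists (fun a : A => val_cqu a (Model qv)); last by move=> x y; exact: (val_gen x y (Model qv)).
split.
- by move=> a b; exact: (val_add a b (Model qv)).
- by move=> c a; exact: (val_scale c a (Model qv)).
- by move=> a b; exact: (val_mul a b (Model qv)).
- exact: (val_one (Model qv)).
- by move=> a; exact: (val_star a (Model qv)).
Qed.

End Existence.

Definition CQu (R : realType) (G : sgraph) : cstarType R[i] := cqu R G.

Definition CQu_gen (R : realType) (G : sgraph) : G -> G -> CQu R G :=
  @cqu_gen R G.

(* This characterizes [CQu R G] up to isomorphism: *-morphisms of C*-algebras
   are automatically continuous, hence determined by their values on a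
   generating family. *)
Theorem CQu_universal (R : realType) (G : sgraph) :
  universal_quantum_automorphism (@CQu_gen R G).
Proof. exact: cqu_universal. Qed.

Definition quantum_symmetry (R : realType) (G : sgraph) : Prop :=
  ~ commutative_cstar (CQu R G).

(* Main.v *)
Require Import Defs.
From HB Require Import structures.
From mathcomp Require Import all_boot all_order all_algebra all_fingroup complex.
From mathcomp Require Import all_classical all_reals topology normedtype.
From mathcomp Require Import ring lra.

(* If [f] and [g] are automorphisms with disjoint supports and [p], [q] are
   projections of a C*-algebra, the product of [p f + (1 - p)] and
   [q g + (1 - q)] is a quantum automorphism having [p] and [q] among its
   entries; take [p] and [q] non-commuting in the 2 x 2 matrices.

   A cograph with at least two vertices has a nontrivial automorphism. So a
   disjoint union that does not satisfy Schmidt's criterion has the form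
   [K1 + H], and [H] does not satisfy it either; by induction [H] or its
   complement is one of the [X_n], [Y_n], and [K1 + (K1 + W)] satisfies the
   criterion as soon as [W] has two vertices.

   Conversely, projections of sum [1] in a C*-algebra are pairwise orthogonal.
   Hence the entries of a quantum automorphism commute on at most three
   vertices, and a quantum automorphism of [K1 + H] fixes [K1] when [H] has no
   isolated vertex; this passes through the recursion defining [X_n], [Y_n]. *)

Set Implicit Arguments.
Unset Strict Implicit.
Unset Printing Implicit Defensive.

Import Order.TTheory GRing.Theory Num.Theory numFieldNormedType.Exports.

Local Open Scope classical_set_scope.
Local Open Scope ring_scope.

(** * Automorphisms of cographs *)

Definition has_automorphism (G : sgraph) :=
  exists2 f : {perm G}, automorphism f & f != 1%g.

Lemma isomorphic_refl (G : sgraph) : isomorphic G G.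
Proof. by exists id => //; exists id. Qed.

Lemma isomorphic_sym (G H : sgraph) : isomorphic G H -> isomorphic H G.
Proof.
move=> [f [g fK gK] fe]; exists g; first by exists f.
by move=> x y; rewrite -{2}[x]gK -{2}[y]gK fe.
Qed.

Lemma isomorphic_trans H G K : isomorphic G H -> isomorphic H K -> isomorphic G K.
Proof.
move=> [f bf fe] [g bg ge]; exists (g \o f); first exact: bij_comp.
by move=> x y /=; rewrite ge fe.
Qed.

Lemma isomorphic_card (G H : sgraph) : isomorphic G H -> #|G| = #|H|.
Proof. by move=> [f bf _]; exact: bij_eq_card bf. Qed.

Lemma isomorphic_complement (G H : sgraph) :
  isomorphic G H -> isomorphic (complement G) (complement H).
Proof.
move=> [f bf fe]; exists f => // x y.
by rewrite /= /compl_edge /= fe (inj_eq (bij_inj bf)).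
Qed.

Lemma complementK (G : sgraph) : isomorphic (complement (complement G)) G.
Proof.
exists id; first by exists id.
move=> x y /=; rewrite /compl_edge /= /compl_edge /=.
by have [->|_] /= := eqVneq x y; rewrite ?edge_irrefl ?negbK.
Qed.

Lemma isomorphic_union G1 G2 H1 H2 : isomorphic G1 H1 -> isomorphic G2 H2 ->
  isomorphic (disjoint_union G1 G2) (disjoint_union H1 H2).
Proof.
move=> [f [f' fK f'K] fe] [g [g' gK g'K] ge].
exists (fun x => match x with inl x => inl (f x) | inr x => inr (g x) end).
  exists (fun x => match x with inl x => inl (f' x) | inr x => inr (g' x) end).
    by case=> x /=; rewrite ?fK ?gK.
  by case=> x /=; rewrite ?f'K ?g'K.
by case=> x [] y //=; rewrite ?fe ?ge.
Qed.

Lemma isomorphic_unionC (G H : sgraph) :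
  isomorphic (disjoint_union G H) (disjoint_union H G).
Proof.
exists (fun x => match x with inl x => inr x | inr x => inl x end).
  by exists (fun x => match x with inl x => inr x | inr x => inl x end); case.
by case=> x [] y.
Qed.

Definition edgeless (G : sgraph) := forall x y : G, edge x y = false.

Lemma isomorphic_edgeless (G H : sgraph) :
  edgeless G -> edgeless H -> #|G| = #|H| -> isomorphic G H.
Proof.
move=> G0 H0 eGH.
exists (fun x => enum_val (cast_ord eGH (enum_rank x))).
  exists (fun x => enum_val (cast_ord (esym eGH) (enum_rank x))) => x;
  by rewrite enum_valK ?cast_ordK ?cast_ordKV enum_rankK.
by move=> x y; rewrite G0 H0.
Qed.

Lemma edgeless_card1 (G : sgraph) : #|G| = 1%N -> edgeless G.
Proof.
move=> /eqP/fintype1P[a Ga] x y.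
by rewrite (Ga x) (Ga y) edge_irrefl.
Qed.

Lemma card_K1 : #|K1| = 1%N. Proof. exact: card_ord. Qed.
Lemma card_K2 : #|K2| = 2%N. Proof. exact: card_ord. Qed.

Lemma card_union (G H : sgraph) : #|disjoint_union G H| = (#|G| + #|H|)%N.
Proof. exact: card_sum. Qed.

Lemma isomorphic_card1 (G H : sgraph) : #|G| = 1%N -> #|H| = 1%N -> isomorphic G H.
Proof.
by move=> G1 H1; apply: isomorphic_edgeless; rewrite ?H1 //; exact: edgeless_card1.
Qed.

Lemma edgeless_compl_K2 : edgeless (complement K2).
Proof. by move=> x y /=; rewrite /compl_edge /= /complete_edge /= andbN. Qed.

Lemma edgeless_union (G H : sgraph) :
  edgeless G -> edgeless H -> edgeless (disjoint_union G H).
Proof. by move=> G0 H0 [x|x] [y|y] //=. Qed.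

(** Up to isomorphism this identifies [X_2] with the complement of [Y_2], where the two families
    meet. *)
Lemma union_K1_compl_K2 : isomorphic (disjoint_union K1 K1) (complement K2).
Proof.
apply: isomorphic_edgeless; last by rewrite card_union !card_ord.
- by apply: edgeless_union; apply: edgeless_card1; rewrite card_ord.
- exact: edgeless_compl_K2.
Qed.

(** * Automorphisms under isomorphisms, complements and disjoint unions *)

Section Transport.
Variables (G H : sgraph) (h : G -> H).
Hypotheses (h_bij : bijective h) (h_edge : {mono h : x y / edge x y}).

Lemma transport_perm (f : {perm G}) : automorphism f ->
  exists2 f' : {perm H}, automorphism f' & forall x, f' (h x) = h (f x).
Proof.
move=> fa; have [h' hK h'K] := h_bij.
have fi : injective (fun x => h (f (h' x))).
  by move=> x y /(bij_inj h_bij) /perm_inj /(can_inj h'K).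
exists (perm fi); last by move=> x; rewrite permE hK.
by move=> x y; rewrite !permE h_edge fa -[in RHS](h'K x) -[in RHS](h'K y) h_edge.
Qed.

Lemma transport_neq1 (f : {perm G}) (f' : {perm H}) :
  (forall x, f' (h x) = h (f x)) -> f != 1%g -> f' != 1%g.
Proof.
move=> ff'; apply: contraNN => /eqP f'1; apply/eqP/permP => x.
by rewrite perm1; apply: (bij_inj h_bij); rewrite -ff' f'1 perm1.
Qed.

End Transport.

Lemma has_automorphism_iso (G H : sgraph) :
  isomorphic G H -> has_automorphism G -> has_automorphism H.
Proof.
move=> [h bh eh] [f fa f1]; have [f' fa' ff'] := transport_perm bh eh fa.
by exists f' => //; exact: transport_neq1 bh _ _ ff' f1.
Qed.

Lemma schmidt_iso (G H : sgraph) :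
  isomorphic G H -> schmidt_criterion G -> schmidt_criterion H.
Proof.
move=> [h bh eh] [f [g [fa ga f1 g1 /pred0P fg]]].
have [f' fa' ff'] := transport_perm bh eh fa.
have [g' ga' gg'] := transport_perm bh eh ga.
exists f', g'; split=> //; [exact: transport_neq1 bh _ _ ff' f1|
  exact: transport_neq1 bh _ _ gg' g1|].
have [h' hK h'K] := bh.
apply/pred0P => x; rewrite -(h'K x) /= !inE ff' gg' !(inj_eq (bij_inj bh)).
by have := fg (h' x); rewrite /= !inE.
Qed.

Lemma automorphism_complement (G : sgraph) (f : {perm G}) :
  automorphism f -> @automorphism (complement G) f.
Proof.
by move=> fa x y; rewrite /= /compl_edge /= fa (inj_eq perm_inj).
Qed.

Lemma has_automorphism_complement (G : sgraph) :
  has_automorphism G -> has_automorphism (complement G).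
Proof. by move=> [f fa f1]; exists f => //; exact: automorphism_complement. Qed.

Lemma schmidt_complement (G : sgraph) :
  schmidt_criterion G -> schmidt_criterion (complement G).
Proof.
move=> [f [g [fa ga f1 g1 fg]]].
by exists f, g; split=> //; exact: automorphism_complement.
Qed.

Section SumPerm.
Variables G H : sgraph.

Definition sum_fun (f : {perm G}) (g : {perm H}) (x : disjoint_union G H) :
    disjoint_union G H :=
  match x with inl x => inl (f x) | inr x => inr (g x) end.

Lemma sum_fun_inj f g : injective (sum_fun f g).
Proof. by move=> [x|x] [y|y] //= [] /perm_inj ->. Qed.

Definition sum_perm f g : {perm disjoint_union G H} := perm (@sum_fun_inj f g).

Lemma automorphism_sum f g :
  automorphism f -> automorphism g -> automorphism (sum_perm f g).
Proof. by move=> fa ga [x|x] [y|y]; rewrite !permE //= ?fa ?ga. Qed.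

Lemma automorphism1 (K : sgraph) : automorphism (1%g : {perm K}).
Proof. by move=> x y; rewrite !perm1. Qed.

Lemma sum_perml_neq1 f : f != 1%g -> sum_perm f 1%g != 1%g.
Proof.
apply: contraNN => /eqP/permP f1; apply/eqP/permP => x.
by have := f1 (inl x); rewrite permE !perm1 /= => -[].
Qed.

Lemma sum_permr_neq1 g : g != 1%g -> sum_perm 1%g g != 1%g.
Proof.
apply: contraNN => /eqP/permP f1; apply/eqP/permP => x.
by have := f1 (inr x); rewrite permE !perm1 /= => -[].
Qed.

Lemma has_automorphism_unionl :
  has_automorphism G -> has_automorphism (disjoint_union G H).
Proof.
move=> [f fa f1]; exists (sum_perm f 1%g); last exact: sum_perml_neq1.
exact: automorphism_sum (@automorphism1 H).
Qed.

Lemma schmidt_union : has_automorphism G -> has_automorphism H ->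
  schmidt_criterion (disjoint_union G H).
Proof.
move=> [f fa f1] [g ga g1]; exists (sum_perm f 1%g), (sum_perm 1%g g); split.
- exact: automorphism_sum (@automorphism1 H).
- exact: automorphism_sum (@automorphism1 G) _.
- exact: sum_perml_neq1.
- exact: sum_permr_neq1.
- apply/pred0P => -[x|x]; rewrite /= !inE !permE /= perm1 eqxx //.
  by rewrite andbF.
Qed.

Lemma schmidt_unionl :
  schmidt_criterion G -> schmidt_criterion (disjoint_union G H).
Proof.
move=> [f [g [fa ga f1 g1 /pred0P fg]]].
exists (sum_perm f 1%g), (sum_perm g 1%g); split.
- exact: automorphism_sum (@automorphism1 H).
- exact: automorphism_sum (@automorphism1 H).
- exact: sum_perml_neq1.
- exact: sum_perml_neq1.
- apply/pred0P => -[x|x]; rewrite /= !inE !permE /= ?perm1 ?eqxx //.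
  by have := fg x; rewrite /= !inE.
Qed.

End SumPerm.

Lemma schmidt_unionr (G H : sgraph) :
  schmidt_criterion H -> schmidt_criterion (disjoint_union G H).
Proof.
by move=> /(schmidt_unionl G) /(schmidt_iso (isomorphic_unionC _ _)).
Qed.

Lemma has_automorphism_unionr (G H : sgraph) :
  has_automorphism H -> has_automorphism (disjoint_union G H).
Proof.
move=> /(has_automorphism_unionl G).
exact: has_automorphism_iso (isomorphic_unionC _ _).
Qed.

Lemma has_automorphism_edgeless2 (G : sgraph) :
  edgeless G -> #|G| = 2%N -> has_automorphism G.
Proof.
move=> G0 G2; have /card_gt1P[x [y [_ _ xy]]] : (1 < #|G|)%N by rewrite G2.
exists (tperm x y); first by move=> a b; rewrite !G0.
by apply/eqP => /permP/(_ x); rewrite tpermL perm1 => /eqP; rewrite eq_sym (negbTE xy).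
Qed.

(** In a union, an automorphism of a summand extends by the identity; if both summands are single
    vertices, they can be swapped. *)
Lemma cograph_has_automorphism (G : sgraph) :
  cograph G -> (1 < #|G|)%N -> has_automorphism G.
Proof.
elim=> {G} [|G H _ IG _ IH _|G _ IG /IG|G H GH _ IG].
- by rewrite card_K1.
- have [/IG|G1] := ltnP 1 #|G|; first exact: has_automorphism_unionl.
  have [/IH|H1] := ltnP 1 #|H|; first exact: has_automorphism_unionr.
  have {}G1 : #|G| = 1%N by apply/eqP; rewrite eqn_leq G1 vertex_gt0.
  have {}H1 : #|H| = 1%N by apply/eqP; rewrite eqn_leq H1 vertex_gt0.
  apply: has_automorphism_edgeless2; last by rewrite card_union G1 H1.
  by apply: edgeless_union; exact: edgeless_card1.
- exact: has_automorphism_complement.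
- by rewrite -(isomorphic_card GH) => /IG; exact: has_automorphism_iso.
Qed.

(** * The families [X_n] and [Y_n] *)

Lemma Z_graphS n L :
  Z_graph n.+2 L = disjoint_union K1 (complement (Z_graph n.+1 L)).
Proof. by []. Qed.

Lemma card_Z_graph n L : #|Z_graph n.+1 L| = (n + #|L|)%N.
Proof.
elim: n => [|n IH] //; rewrite Z_graphS card_union card_K1 add1n.
by congr _.+1.
Qed.

Lemma cograph_Z_graph n L : cograph L -> cograph (Z_graph n.+1 L).
Proof.
move=> cL; elim: n => [|n IH] //; rewrite Z_graphS.
by apply: cograph_union; [exact: cograph_K1|exact: cograph_complement].
Qed.

Lemma cograph_K2 : cograph K2.
Proof.
apply: (@cograph_iso (complement (complement K2))); first exact: complementK.
apply/cograph_complement/(cograph_iso union_K1_compl_K2).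
by apply: cograph_union; exact: cograph_K1.
Qed.

(** One automorphism swaps the two isolated vertices, the other acts on [H]. *)
Lemma schmidt_two_isolated H : cograph H -> (1 < #|H|)%N ->
  schmidt_criterion (disjoint_union K1 (disjoint_union K1 H)).
Proof.
move=> cH H1.
suff : schmidt_criterion (disjoint_union (disjoint_union K1 K1) H).
  apply: schmidt_iso.
  exists (fun x => match x with
    | inl (inl x) => inl x | inl (inr x) => inr (inl x) | inr x => inr (inr x) end).
    exists (fun x => match x with
      | inl x => inl (inl x) | inr (inl x) => inl (inr x) | inr (inr x) => inr x end).
      by case=> [[]|].
    by case=> [|[]].
  by case=> [[]|] x [[]|] y.
apply: schmidt_union; apply: cograph_has_automorphism => //.
  by apply: cograph_union; exact: cograph_K1.
by rewrite card_union !card_K1.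
Qed.

(* [0 < m] excludes the junk value [Y_graph 1 = K2]. *)
Definition in_XY (m : nat) (G : sgraph) :=
  [\/ isomorphic G (X_graph m.+1), isomorphic G (complement (X_graph m.+1)),
      (0 < m)%N /\ isomorphic G (Y_graph m.+1)
    | (0 < m)%N /\ isomorphic G (complement (Y_graph m.+1))].

Lemma in_XY_iso m (G H : sgraph) : isomorphic G H -> in_XY m G -> in_XY m H.
Proof.
move=> /isomorphic_sym HG [/(isomorphic_trans HG)|/(isomorphic_trans HG)|
  [m0 /(isomorphic_trans HG)]|[m0 /(isomorphic_trans HG)]] ?.
- by constructor 1.
- by constructor 2.
- by constructor 3.
- by constructor 4.
Qed.

Lemma in_XY_complement m (G : sgraph) : in_XY m G -> in_XY m (complement G).
Proof.
move=> [/isomorphic_complement h|/isomorphic_complement h|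
  [m0 /isomorphic_complement h]|[m0 /isomorphic_complement h]].
- by constructor 2.
- by constructor 1; apply: isomorphic_trans h _; exact: complementK.
- by constructor 4.
- by constructor 3; split=> //; apply: isomorphic_trans h _; exact: complementK.
Qed.

Lemma in_XY_card m (G : sgraph) : in_XY m G -> #|G| = m.+1.
Proof.
have cY : (0 < m)%N -> #|Y_graph m.+1| = m.+1.
  by case: m => // m _; rewrite card_Z_graph card_K2 addn2.
have cX : #|X_graph m.+1| = m.+1 by rewrite card_Z_graph card_K1 addn1.
by move=> [/isomorphic_card ->|/isomorphic_card ->|
  [m0 /isomorphic_card ->]|[m0 /isomorphic_card ->]] //; exact: cY.
Qed.

Lemma in_XY_K1 (G : sgraph) : #|G| = 1%N -> in_XY 0 G.
Proof. by move=> G1; constructor 1; apply: isomorphic_card1 => //; exact: card_K1. Qed.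

(** If [H] is the complement of a member, the recursion gives the next member. If [H] is a member on
    at least three vertices, it is itself [K1 + W] with [W] on at least two, and the criterion would
    hold. There remain [X_1], [X_2] and [Y_2], which lead to [X_2], [Y_3] and [X_3]. *)
Lemma in_XY_union_K1 m H : ~ schmidt_criterion (disjoint_union K1 H) ->
  in_XY m H -> exists m', in_XY m' (disjoint_union K1 H).
Proof.
have iU A B : isomorphic A B -> isomorphic (disjoint_union K1 A) (disjoint_union K1 B).
  exact: isomorphic_union (isomorphic_refl _).
move=> nS [iH|iH|[m0 iH]|[m0 iH]].
- move: m iH => [|[|m]] iH.
  + exists 1%N; constructor 1; apply: (iU); apply: isomorphic_trans iH _.
    by apply: isomorphic_card1; rewrite card_K1.
  + exists 2%N; constructor 3; split=> //; apply: (iU); apply: isomorphic_trans iH _.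
    apply: isomorphic_trans (iU _ K1 _) union_K1_compl_K2.
    by apply: isomorphic_card1; rewrite card_K1.
  + case: nS; apply: schmidt_iso (isomorphic_sym (iU _ _ iH)) _.
    rewrite /X_graph Z_graphS; apply: schmidt_two_isolated.
      by apply/cograph_complement/cograph_Z_graph/cograph_K1.
    by rewrite [#|_|]card_Z_graph addSn card_K1 addn1.
- by exists m.+1; constructor 1; apply: iU.
- move: m m0 iH => [|[|m]] // _ iH.
  + exists 2%N; constructor 1; apply: (iU); apply: isomorphic_trans iH _.
    apply: isomorphic_trans (isomorphic_sym (complementK _)) _.
    apply: isomorphic_complement; apply: isomorphic_trans (isomorphic_sym union_K1_compl_K2) _.
    by apply: (iU); apply: isomorphic_card1; rewrite card_K1.
  + case: nS; apply: schmidt_iso (isomorphic_sym (iU _ _ iH)) _.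
    rewrite /Y_graph /= Z_graphS; apply: schmidt_two_isolated.
      exact/cograph_complement/cograph_Z_graph/cograph_K2.
    by rewrite [#|_|]card_Z_graph card_K2 addn2.
(* [Y_graph] follows the recursion only from index two on, hence the exclusion of [m = 0]. *)
- by exists m.+1; constructor 3; split=> //; case: m m0 iH => // m _ iH; apply: iU.
Qed.

Lemma not_schmidt_in_XY (G : sgraph) :
  cograph G -> ~ schmidt_criterion G -> exists m, in_XY m G.
Proof.
elim=> {G} [_|G H cG IG cH IH nS|G _ IG nS|G H GH _ IG nS].
- by exists 0%N; apply: in_XY_K1; exact: card_K1.
- have [m Gm] := IG (fun s => nS (schmidt_unionl H s)).
  have [k Hk] := IH (fun s => nS (schmidt_unionr G s)).
  have isoK1 (L : sgraph) : (#|L| <= 1)%N -> isomorphic L K1.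
    move=> L1; apply: isomorphic_card1; last exact: card_K1.
    by apply/eqP; rewrite eqn_leq L1 vertex_gt0.
  have [G1|G1] := leqP #|G| 1.
    have iG := isomorphic_union (isoK1 _ G1) (isomorphic_refl H).
    have [] := in_XY_union_K1 _ Hk.
      by move=> /(schmidt_iso (isomorphic_sym iG)).
    by move=> m' /(in_XY_iso (isomorphic_sym iG)); exists m'.
  have [H1|H1] := leqP #|H| 1.
    have iG := isomorphic_trans (isomorphic_unionC G H)
      (isomorphic_union (isoK1 _ H1) (isomorphic_refl G)).
    have [] := in_XY_union_K1 _ Gm.
      by move=> /(schmidt_iso (isomorphic_sym iG)).
    by move=> m' /(in_XY_iso (isomorphic_sym iG)); exists m'.
  by case: nS; apply: schmidt_union; exact: cograph_has_automorphism.
- have [m Gm] := IG (fun s => nS (schmidt_complement s)).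
  by exists m; exact: in_XY_complement.
- have [m Gm] := IG (fun s => nS (schmidt_iso GH s)).
  by exists m; exact: in_XY_iso Gm.
Qed.

(** * Projections in a C*-algebra *)

Section RealNorm.
Variables (R : realType) (A : cstarType R[i]).
Implicit Types x y : A.

(** The norm has values in [R[i]]; its real part lies in [R], where linear arithmetic and the
    Archimedean property apply. *)
Definition rnorm x : R := complex.Re `|x|.

Lemma rnormE x : `|x| = (rnorm x)%:C%C.
Proof. by apply: norm_Re; exact: normr_ge0. Qed.

Lemma cscale_mull (c : R[i]) x y : (c *: x) * y = c *: (x * y).
Proof. exact/esym/cscaleAl. Qed.

Lemma cscale_mulr (c : R[i]) x y : x * (c *: y) = c *: (x * y).
Proof. exact/esym/cscaleAr. Qed.

Lemma rnorm_le x (r : R) : (rnorm x <= r) = (`|x| <= r%:C%C).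
Proof. by rewrite rnormE lecR. Qed.

Lemma rnorm_ge0 x : 0 <= rnorm x.
Proof. by rewrite -lecR -rnormE; exact: normr_ge0. Qed.

Lemma rnormD x y : rnorm (x + y) <= rnorm x + rnorm y.
Proof. by rewrite -lecR rmorphD /= -!rnormE ler_normD. Qed.

Lemma rnormN x : rnorm (- x) = rnorm x.
Proof. by rewrite /rnorm normrN. Qed.

Lemma rnormB x y : rnorm (x - y) <= rnorm x + rnorm y.
Proof. by rewrite -(rnormN y) rnormD. Qed.

Lemma rnormM x y : rnorm (x * y) <= rnorm x * rnorm y.
Proof. by rewrite -lecR rmorphM /= -!rnormE normM_le. Qed.

Lemma rnormZ (r : R) x : 0 <= r -> rnorm (r%:C%C *: x) = r * rnorm x.
Proof.
move=> r0; apply: complexI; rewrite rmorphM /= -!rnormE normrZ ger0_norm //.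
by rewrite lecR.
Qed.

Lemma rnorm0_eq0 x : rnorm x <= 0 -> x = 0.
Proof.
move=> x0; apply/eqP; rewrite -normr_eq0 rnormE.
by have -> : rnorm x = 0 by apply/eqP; rewrite eq_le x0 rnorm_ge0.
Qed.

Lemma rnorm_projection x : star x = x -> x * x = x -> rnorm x <= 1.
Proof. by move=> sx xx; rewrite rnorm_le norm_projection. Qed.

Lemma rnorm_sum (I : finType) (P : pred I) (F : I -> A) :
  rnorm (\sum_(i | P i) F i) <= \sum_(i | P i) rnorm (F i).
Proof.
apply: (big_ind2 (fun a b => rnorm a <= b)) => //.
  by rewrite /rnorm normr0.
by move=> a b c d ab cd; rewrite (le_trans (rnormD _ _)) // lerD.
Qed.

End RealNorm.

(** * The unit of a corner as an extreme point of the unit ball *)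

Section ExtremePoint.
Variables (R : realType) (A : cstarType R[i]) (e : A).
Hypothesis ee : e * e = e.

(** The two equations put [h] in the corner [e A e], whose unit is [e]; the bounds make [e] the
    midpoint of two contractions. *)
Definition ball_pair (h : A) :=
  [/\ e * h = h, h * e = h, rnorm (e + h) <= 1 & rnorm (e - h) <= 1].

Section Cubic.
Variable h : A.
Hypotheses (eh : e * h = h) (he : h * e = h).

(** Polynomials of degree at most 3 in [h], so that identities between products of [e + h] and
    [e - h] reduce to coefficients. *)
Let comb (a b c d : R) : A :=
  a%:C%C *: e + b%:C%C *: h + c%:C%C *: (h * h) + d%:C%C *: (h * h * h).

Let combD a b c d a' b' c' d' :
  comb a b c d + comb a' b' c' d' = comb (a + a') (b + b') (c + c') (d + d').
Proof.
rewrite /comb !rmorphD /= !scalerDl !addrA.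
by rewrite [LHS](ACl (1*5*2*6*3*7*4*8)).
Qed.

Let combZ r a b c d : r%:C%C *: comb a b c d = comb (r * a) (r * b) (r * c) (r * d).
Proof. by rewrite /comb !scalerDr !scalerA !rmorphM. Qed.

Let combN a b c d : - comb a b c d = comb (- a) (- b) (- c) (- d).
Proof. by rewrite /comb !rmorphN /= !scaleNr !opprD. Qed.

Let combM a b a' b' c' : comb a b 0 0 * comb a' b' c' 0 =
  comb (a' * a) (b' * a + a' * b) (c' * a + b' * b) (c' * b).
Proof.
rewrite /comb !scale0r !addr0 !mulrDr !mulrDl !cscale_mulr !cscale_mull !scalerA.
rewrite !(mulrA e) ee eh he (mulrA h).
rewrite !rmorphD !rmorphM /= !scalerDl !addrA.
by rewrite [LHS](ACl (1*3*2*5*4*6)).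
Qed.

(** The polynomial [(3t - t^3)/2] has slope 3/2 at 0, and [1 + (3t - t^3)/2] equals
    [(1+t)^3/4 + 3(1+t)^2(1-t)/4], a convex combination of products of three contractions. Changing
    the sign of [t] treats [e - cubic]. *)
Definition cubic : A := (3 / 2)%:C%C *: h - (1 / 2)%:C%C *: (h * h * h).

Let eDh : e + h = comb 1 1 0 0.
Proof. by rewrite /comb !scale0r !scale1r !addr0. Qed.

Let eBh : e - h = comb 1 (-1) 0 0.
Proof. by rewrite /comb !scale0r rmorphN scaleN1r !scale1r !addr0. Qed.

Let combE a b c d a' b' c' d' : a = a' -> b = b' -> c = c' -> d = d' ->
  comb a b c d = comb a' b' c' d'.
Proof. by move=> -> -> -> ->. Qed.

Let eDcubic : e + cubic =
  (1/4)%:C%C *: ((e + h) * ((e + h) * (e + h))) +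
  (3/4)%:C%C *: ((e + h) * ((e + h) * (e - h))).
Proof.
transitivity (comb 1 (3/2) 0 (-(1/2))).
  by rewrite /comb /cubic rmorphN scaleNr scale0r scale1r addr0 addrA.
rewrite eBh !eDh !combM; rewrite ?(mulr0, mul0r, addr0).
by rewrite !combM !combZ combD; apply: combE; field.
Qed.

Let eBcubic : e - cubic =
  (1/4)%:C%C *: ((e - h) * ((e - h) * (e - h))) +
  (3/4)%:C%C *: ((e - h) * ((e - h) * (e + h))).
Proof.
transitivity (comb 1 (-(3/2)) 0 (1/2)).
  by rewrite /comb /cubic rmorphN scaleNr scale0r scale1r addr0 opprD opprK addrA.
rewrite !eBh !eDh !combM; rewrite ?(mulr0, mul0r, addr0).
by rewrite !combM !combZ combD; apply: combE; field.
Qed.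

Let eight_h : h =
  (1/8)%:C%C *: ((e + h) * ((e + h) * (e + h)) - (e - h) * ((e - h) * (e - h))
  + ((e + h) * ((e + h) * (e - h)) - (e - h) * ((e - h) * (e + h)))).
Proof.
transitivity (comb 0 1 0 0); first by rewrite /comb !scale0r scale1r !addr0 add0r.
rewrite !eBh !eDh !combM; rewrite ?(mulr0, mul0r, addr0).
by rewrite !combM !combN !combD combZ; apply: combE; field.
Qed.

Hypotheses (Dh : rnorm (e + h) <= 1) (Bh : rnorm (e - h) <= 1).

Let mul3 x y z : rnorm x <= 1 -> rnorm y <= 1 -> rnorm z <= 1 ->
  rnorm (x * (y * z) : A) <= 1.
Proof.
move=> x1 y1 z1; rewrite (le_trans (rnormM _ _)) // mulr_ile1 ?rnorm_ge0 //.
by rewrite (le_trans (rnormM _ _)) // mulr_ile1 ?rnorm_ge0.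
Qed.

Let convex x y : rnorm x <= 1 -> rnorm y <= 1 ->
  rnorm ((1/4)%:C%C *: x + (3/4)%:C%C *: y : A) <= 1.
Proof.
move=> x1 y1; have := rnormD ((1/4)%:C%C *: x) ((3/4)%:C%C *: y).
by rewrite !rnormZ; lra.
Qed.

Lemma ball_pair_cubic : ball_pair cubic.
Proof.
split.
- by rewrite /cubic mulrBr !cscale_mulr !mulrA eh.
- by rewrite /cubic mulrBl !cscale_mull -(mulrA _ h e) he.
- by rewrite eDcubic; apply: convex; exact: mul3.
- by rewrite eBcubic; apply: convex; exact: mul3.
Qed.

(** [eight_h] writes [8h] as a signed sum of four products of three contractions, whence 4/8. The
    bound 1 coming from [2h = (e + h) - (e - h)] would be too weak to make [cubic] expand. *)
Lemma rnorm_half : rnorm h <= 1/2.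
Proof.
rewrite eight_h rnormZ; last lra.
pose a := (e + h) * ((e + h) * (e + h)); pose b := (e - h) * ((e - h) * (e - h)).
pose c := (e + h) * ((e + h) * (e - h)); pose d := (e - h) * ((e - h) * (e + h)).
have := rnormD (a - b) (c - d); have := rnormB a b; have := rnormB c d.
have : rnorm a <= 1 by exact: mul3.
have : rnorm b <= 1 by exact: mul3.
have : rnorm c <= 1 by exact: mul3.
have : rnorm d <= 1 by exact: mul3.
rewrite -/a -/b -/c -/d; lra.
Qed.

(** By [rnorm_half] the cube has at most a quarter of the norm of [h], and the resulting factor 3/2
    - 1/8 exceeds 5/4. *)
Lemma rnorm_cubic : 5/4 * rnorm h <= rnorm cubic.
Proof.
have h2 := rnorm_half; have h0 := rnorm_ge0 h.
have hh := rnormM h h; have hhh := rnormM (h * h) h.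
have : rnorm (h * h * h) <= 1/4 * rnorm h.
  rewrite (le_trans hhh) // ler_wpM2r // (le_trans hh) //.
  by rewrite (le_trans (ler_pM _ _ h2 h2)) //; lra.
have : rnorm ((3/2)%:C%C *: h) <= rnorm cubic + rnorm ((1/2)%:C%C *: (h * h * h)).
  by rewrite -{1}[_ *: h](subrK ((1/2)%:C%C *: (h * h * h))) rnormD.
by rewrite !rnormZ; lra.
Qed.

End Cubic.

(* The unit of a Banach algebra is an extreme point of the unit ball; here for
   the corner of unit [e]. [cubic] preserves the pairs of contractions
   [e + h], [e - h] and expands [h] by the factor 5/4, so [h = 0]. *)
Lemma ball_pair_eq0 h : ball_pair h -> h = 0.
Proof.
(* Linear growth in [n] replaces the powers of 5/4, because [(n + 4) * 5/4] is at least [n + 5]. *)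
have key n : forall h, ball_pair h -> (n%:R + 4) * rnorm h <= 4.
  elim: n => [|n IH] k [ek ke Dk Bk].
    by have := rnorm_half ek ke Dk Bk; lra.
  have := IH _ (ball_pair_cubic ek ke Dk Bk).
  apply: le_trans; have k5 := rnorm_cubic ek ke Dk Bk.
  have n0 : 0 <= n%:R + 4 :> R by rewrite addr_ge0.
  apply: le_trans (ler_wpM2l n0 k5).
  rewrite mulrA ler_wpM2r ?rnorm_ge0 // -natr1.
  have : 0 <= n%:R :> R by []. lra.
move=> bh; apply: rnorm0_eq0; rewrite leNgt; apply/negP => h0.
have := key (Num.bound (4 / rnorm h)) _ bh.
have := archi_boundP (ltW (divr_gt0 (ltr0n R 4) h0)).
rewrite ltr_pdivrMr //; lra.
Qed.

End ExtremePoint.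

Section OrthogonalProjections.
Variables (R : realType) (A : cstarType R[i]).
Implicit Types x y p : A.

Definition projection p := star p = p /\ p * p = p.

Lemma starN x : star (- x) = - star x.
Proof. by rewrite -scaleN1r starZ rmorphN1 scaleN1r. Qed.

Lemma projectionC p : projection p -> projection (1 - p).
Proof.
move=> [sp pp]; split; first by rewrite starD starN star1 sp.
by rewrite mulrBl mul1r mulrBr mulr1 pp subrr subr0.
Qed.

Lemma rnorm_compression e p : projection e -> projection p ->
  rnorm (e * p * e) <= 1.
Proof.
move=> [se ee] [sp pp]; have e1 := rnorm_projection se ee.
have p1 := rnorm_projection sp pp.
rewrite (le_trans (rnormM _ _)) // mulr_ile1 ?rnorm_ge0 //.
by rewrite (le_trans (rnormM _ _)) // mulr_ile1 ?rnorm_ge0.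
Qed.

Lemma star_mul_eq0 x : star x * x = 0 -> x = 0.
Proof.
by move=> xx; apply/eqP; rewrite -normr_eq0 -sqrf_eq0 -norm_starM xx normr0.
Qed.

(** With [e = p j], the compressions [h k = e (p k) e] add up to [e = h j], so those with [k != j]
    add up to 0. Contractions [e - h k] then control both signs of [h i]; the extreme point property
    gives [h i = 0], and [h i] is [star x * x] for [x = p i * e]. *)
Lemma orthogonal_projections (I : finType) (p : I -> A) i j :
  (forall k, projection (p k)) -> \sum_k p k = 1 -> i != j -> p i * p j = 0.
Proof.
move=> proj sum1 ij; set e := p j; have [se ee] := proj j.
pose h k := e * p k * e.
have e1 : rnorm e <= 1 by exact: rnorm_projection.
have eBh k : rnorm (e - h k) <= 1.
  rewrite (_ : e - h k = e * (1 - p k) * e).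
    by apply: rnorm_compression => //; exact: projectionC.
  by rewrite mulrBr mulrBl mulr1 ee.
pose P := [pred k | (k != j) && (k != i)].
have hi : - h i = \sum_(k | P k) h k.
  have : \sum_k h k = e by rewrite -mulr_suml -mulr_sumr sum1 mulr1.
  rewrite (bigD1 j) //= (bigD1 i) //= {1}/h ee ee => /(canRL (addKr e)).
  by rewrite addNr => /eqP; rewrite addr_eq0 => /eqP ->; rewrite opprK.
pose m := #|P|; have m0 : (0 : R) < m.+1%:R by rewrite ltr0n.
(* The scale fits because [(m+1) e + h i] is the sum of [e] and of the [m] contractions [e - h k]
   for [k] in [P], while [(m+1) e - h i] is [m e + (e - h i)]. *)
pose k := (m.+1%:R^-1)%:C%C *: h i.
have mV : 0 <= m.+1%:R^-1 :> R by rewrite invr_ge0 ltW.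
have scale x : x = (m.+1%:R^-1)%:C%C *: (x *+ m.+1).
  rewrite -(scaler_nat m.+1 x) scalerA -(rmorph_nat (real_complex R)) -rmorphM /=.
  by rewrite mulVf ?scale1r // gt_eqF.
have k0 : k = 0.
  apply: (@ball_pair_eq0 _ _ e ee); split.
  - by rewrite /k cscale_mulr /h !mulrA ee.
  - by rewrite /k cscale_mull /h -!mulrA ee.
  - rewrite [e in e + _]scale /k -scalerDr rnormZ // mulrC ler_pdivrMr // mul1r.
    rewrite -[h i]opprK hi mulrS -addrA -sumr_const -sumrB.
    rewrite (le_trans (rnormD _ _)) // -natr1 addrC lerD //.
    rewrite (le_trans (rnorm_sum _ _)) // /m -sum1_card natr_sum.
    by apply: ler_sum => l _; exact: eBh.
  - rewrite [e in e - _]scale /k -scalerBr rnormZ // mulrC ler_pdivrMr // mul1r.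
    rewrite mulrSr -addrA (le_trans (rnormD _ _)) // -natr1 lerD ?eBh //.
    rewrite -sumr_const (le_trans (rnorm_sum _ _)) // /m -sum1_card natr_sum.
    by apply: ler_sum => l _.
have hi0 : h i = 0.
  have /eqP := k0; rewrite scaler_eq0 => /orP[|/eqP //].
  by rewrite (fmorph_eq0 (real_complex R)) invr_eq0 gt_eqF.
have [si ii] := proj i.
by apply: star_mul_eq0; rewrite starM se si mulrA -(mulrA e) ii.
Qed.

End OrthogonalProjections.

(** * Quantum automorphisms and classical symmetry *)

Section QuantumAutomorphism.
Variables (R : realType) (A : cstarType R[i]) (G : sgraph) (u : G -> G -> A).
Hypothesis qu : quantum_automorphism u.

Lemma quantum_row_orthogonal x y z : y != z -> u x y * u x z = 0.
Proof.
have [proj row _ _] := qu.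
by apply: (@orthogonal_projections _ _ _ (u x)) => // k; exact: proj.
Qed.

Lemma quantum_col_orthogonal x y z : x != z -> u x y * u z y = 0.
Proof.
have [proj _ col _] := qu.
by apply: (@orthogonal_projections _ _ _ (u^~ y)) => // k; exact: proj.
Qed.

(** Multiply entry [(x, y)] of the adjacency relation by [u x w] on the left: row orthogonality
    leaves [u x w] on one side, and the other vanishes as [x] is isolated. *)
Lemma quantum_isolated_row x w y :
  (forall z, edge x z = false) -> edge w y -> u x w = 0.
Proof.
move=> x0 wy; have [proj _ _ adj] := qu.
have := congr1 (fun a => u x w * a) (adj x y); rewrite /= !mulr_sumr.
rewrite (bigD1 w) //= big1 => [|z zw]; last first.
  by rewrite mulrA quantum_row_orthogonal ?mul0r // eq_sym.
rewrite wy mulr1 addr0 (proj x w).2 => ->.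
by rewrite big1 // => z _; rewrite x0 mul0r mulr0.
Qed.

(** The transposed argument, with [u w y] on the right and column orthogonality. *)
Lemma quantum_isolated_col x w y :
  (forall z, edge y z = false) -> edge x w -> u w y = 0.
Proof.
move=> y0 xw; have [proj _ _ adj] := qu.
have := congr1 (fun a => a * u w y) (adj x y); rewrite /= !mulr_suml.
rewrite [in RHS](bigD1 w) //= [X in _ = _ + X]big1 => [|z zw]; last first.
  by rewrite -mulrA quantum_col_orthogonal ?mulr0.
rewrite xw mul1r addr0 (proj w y).2 => <-.
by rewrite big1 // => z _; rewrite edge_sym y0 mulr0 mul0r.
Qed.

End QuantumAutomorphism.

(** Quantifying over all C*-algebras lets the property pass between graphs: a quantum automorphism
    of one is turned into one of the other over the same algebra. *)
Definition classical_symmetry (R : realType) (G : sgraph) :=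
  forall (A : cstarType R[i]) (u : G -> G -> A), quantum_automorphism u ->
  forall x y x' y', u x y * u x' y' = u x' y' * u x y.

Section ClassicalSymmetry.
Variable R : realType.
Local Notation classical := (classical_symmetry R).

Lemma classical_iso (G H : sgraph) : isomorphic G H -> classical H -> classical G.
Proof.
move=> [f [g fK gK] fe] cH A u [proj row col adj].
have bg : bijective g by exists f.
have ge x y : edge (g x) (g y) = edge x y by rewrite -fe !gK.
pose v x y := u (g x) (g y).
have qv : quantum_automorphism v.
  split=> [x y|x|x|x y]; first exact: proj.
  - by rewrite -(row (g x)) [RHS](reindex g) //; exact: onW_bij.
  - by rewrite -(col (g x)) [RHS](reindex g) //; exact: onW_bij.
  - have := adj (g x) (g y); rewrite (reindex g); last exact: onW_bij.
    rewrite [RHS](reindex g); last exact: onW_bij.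
    by under eq_bigr do rewrite ge; under [RHS]eq_bigr do rewrite ge.
by move=> x y x' y'; rewrite -[x]fK -[y]fK -[x']fK -[y']fK; exact: cH qv _ _ _ _.
Qed.

(** The adjacency matrix of [G] is [J - 1 - B], with [B] that of the complement and [J] all ones;
    [u] commutes with [J] because its rows and columns sum to 1. *)
Lemma classical_complement (G : sgraph) : classical G -> classical (complement G).
Proof.
move=> cG A u [proj row col adj]; apply: cG; split=> // x y.
have cE (z w : G) : (edge z w)%:R
    = 1 - (z == w)%:R - (@edge (complement G) z w)%:R :> A.
  rewrite /= /compl_edge /=; have [->|zw] /= := eqVneq z w.
    by rewrite edge_irrefl subrr subr0.
  by case: edge; rewrite /= !subr0 // subrr.
transitivity (1 - u x y - \sum_(z : G) u x z * (@edge (complement G) z y)%:R).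
  rewrite (eq_bigr (fun z => u x z - u x z * (z == y)%:R
    - u x z * (@edge (complement G) z y)%:R)) => [|z _]; last first.
    by rewrite cE !mulrBr mulr1.
  rewrite !sumrB row; congr (_ - _ - _).
  rewrite (bigD1 y) //= eqxx mulr1 big1 ?addr0 // => z /negbTE ->.
  by rewrite mulr0.
rewrite adj [RHS](eq_bigr (fun z => u z y - (x == z)%:R * u z y
    - (@edge (complement G) x z)%:R * u z y)) => [|z _]; last first.
  by rewrite cE !mulrBl mul1r.
rewrite !sumrB col; congr (_ - _ - _).
rewrite (bigD1 x) //= eqxx mul1r big1 ?addr0 // => z zx.
by rewrite eq_sym (negbTE zx) mul0r.
Qed.

(** For distinct rows and columns, [a = u x y] and [b = u x' y'] satisfy [a b = a b a]. This is
    self-adjoint, so [a b = b a]. *)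
Lemma classical_card_le3 (G : sgraph) : (#|G| <= 3)%N -> classical G.
Proof.
move=> G3 A u qu x y x' y'; have [proj row col _] := qu.
have rowO := quantum_row_orthogonal qu; have colO := quantum_col_orthogonal qu.
have [->|xx'] := eqVneq x x'.
  by have [->//|yy'] := eqVneq y y'; rewrite !rowO // eq_sym.
have [->|yy'] := eqVneq y y'; first by rewrite !colO // eq_sym.
have E : u x y * u x' y' = u x y * u x' y' * u x y.
  rewrite -[LHS]mulr1 -(row x) mulr_sumr (bigD1 y) //= big1 ?addr0 // => z zy.
  have [->|zy'] := eqVneq z y'; first by rewrite -mulrA colO ?mulr0 // eq_sym.
  (* Here [z] is the third column. The other entries of row [x'] in columns [y] and [z] are killed
     by column orthogonality, and there is no fourth column. *)
  have -> : u x' y' = 1 - \sum_(w | w != y') u x' w.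
    by rewrite -(row x') (bigD1 y') //= addrK.
  rewrite mulrBr mulr1 mulrBl rowO 1?eq_sym // mulr_sumr mulr_suml big1 ?subr0 //.
  move=> w wy'; have [->|wy] := eqVneq w y; first by rewrite colO // mul0r.
  have [->|wz] := eqVneq w z; first by rewrite -mulrA colO ?mulr0 // eq_sym.
  have uq : uniq [:: w; y; z; y'].
    by rewrite /= !inE !negb_or wy wz wy' yy' zy' (eq_sym y) zy.
  by have := leq_trans (max_card (mem [:: w; y; z; y'])) G3; rewrite (card_uniqP uq).
have := congr1 (@star _ _) E.
rewrite !starM !(proj _ _).1 => ->.
by rewrite mulrA -E.
Qed.

(** By the two lemmas on isolated vertices, [u] is block diagonal with entry 1 at [K1]; the other
    block is a quantum automorphism of [H]. *)
Lemma classical_union_K1 (H : sgraph) :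
  (forall x : H, exists y, edge x y) -> classical H ->
  classical (disjoint_union K1 H).
Proof.
move=> H1 cH A u qu; have [proj row col adj] := qu.
have u12 a x : u (inl a) (inr x) = 0.
  have [y xy] := H1 x.
  apply: (@quantum_isolated_row _ _ _ _ qu _ _ (inr y)) => // -[z|//].
  by rewrite (ord1 a) (ord1 z) edge_irrefl.
have u21 a x : u (inr x) (inl a) = 0.
  have [y xy] := H1 x.
  apply: (@quantum_isolated_col _ _ _ _ qu (inr y)); last by rewrite edge_sym.
  by move=> [z|//]; rewrite (ord1 a) (ord1 z) edge_irrefl.
have u11 a b : u (inl a) (inl b) = 1.
  rewrite -(row (inl a)) big_sumType /= [X in _ + X]big1 // addr0.
  by rewrite big_ord1 (ord1 b).
have qv : quantum_automorphism (fun x y : H => u (inr x) (inr y)).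
  split=> [x y|x|x|x y]; first exact: proj.
  - by rewrite -(row (inr x)) big_sumType /= [X in _ = X + _]big1 ?add0r.
  - by rewrite -(col (inr x)) big_sumType /= [X in _ = X + _]big1 ?add0r.
  - have := adj (inr x) (inr y).
    by rewrite !big_sumType /= !big_ord1 mulr0 mul0r !add0r.

have c1 (a : A) : a * 1 = 1 * a by rewrite mulr1 mul1r.
have c0 (a : A) : a * 0 = 0 * a by rewrite mulr0 mul0r.
by move=> [x|x] [y|y] [x'|x'] [y'|y']; rewrite ?u11 ?u12 ?u21 ?c1 ?c0 //; exact: cH qv _ _ _ _.
Qed.

(** The complement joins every vertex of a summand to all of the other. This supplies the hypothesis
    of [classical_union_K1] along the recursion. *)
Lemma complement_union_no_isolated (G H : sgraph) (x : complement (disjoint_union G H)) :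
  exists y, edge x y.
Proof.
have /card_gt0P[g _] := vertex_gt0 G; have /card_gt0P[h _] := vertex_gt0 H.
by case: x => x; [exists (inr h)|exists (inl g)].
Qed.

Lemma classical_Z_graph n (L : sgraph) : (#|L| <= 2)%N -> classical (Z_graph n L).
Proof.
move=> L2; case: n => [|n]; first by apply: classical_card_le3; exact: leqW.
elim: n => [|[_|n IH]]; first by apply: classical_card_le3; exact: leqW.
  (* [Z_graph 2 L] is settled by its size, since the complement of [L] may have isolated
     vertices. *)
  by apply: classical_card_le3; rewrite Z_graphS card_union card_K1.
rewrite Z_graphS; apply: classical_union_K1; last exact: classical_complement.
by move=> x; rewrite Z_graphS in x *; exact: complement_union_no_isolated.
Qed.

Lemma classical_in_XY m G : in_XY m G -> classical G.
Proof.
move=> [/classical_iso|/classical_iso|[_ /classical_iso]|[_ /classical_iso]]; apply.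
- by apply: classical_Z_graph; rewrite card_K1.
- by apply/classical_complement/classical_Z_graph; rewrite card_K1.
- by apply: classical_Z_graph; rewrite card_K2.
- by apply/classical_complement/classical_Z_graph; rewrite card_K2.
Qed.

(** If [c] commutes with [b], the commutator of [a] and [b] is that of [a - c] and [b], which is
    small when [c] is close to [a]. *)
Lemma closed_commutant (A : cstarType R[i]) (b : A) :
  closed [set a : A | a * b = b * a].
Proof.
move=> a clA; apply/eqP; rewrite -subr_eq0; apply/eqP; apply: rnorm0_eq0.
rewrite leNgt; apply/negP => d0.
(* The added 1 keeps the divisor positive when [b = 0] and makes the final comparison
   contradictory. *)
have b0 : 0 < 2 * rnorm b + 1 :> R by have := rnorm_ge0 b; lra.
pose r := rnorm (a * b - b * a) / (2 * rnorm b + 1).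
have r0 : 0 < r by exact: divr_gt0.
have r0C : 0 < r%:C%C by rewrite ltcR.
have [c [/= cb]] := clA _ (nbhsx_ballx a (r%:C%C) r0C).
rewrite -ball_normE /= rnormE ltcR => ac.
have : rnorm (a * b - b * a) <= 2 * rnorm b * rnorm (a - c).
  have -> : a * b - b * a = (a - c) * b - b * (a - c).
    by rewrite mulrBl mulrBr cb opprB addrA subrK.
  have := rnormB ((a - c) * b) (b * (a - c)).
  by have := rnormM (a - c) b; have := rnormM b (a - c); lra.
have : rnorm (a * b - b * a) = r * (2 * rnorm b + 1) by rewrite divfK // gt_eqF.
have : 2 * rnorm b * rnorm (a - c) <= 2 * rnorm b * r.
  by rewrite ler_wpM2l ?mulr_ge0 ?rnorm_ge0 // ltW.
lra.
Qed.

(** The commutant of a star-stable set [B] is a closed star-subalgebra, hence everything once it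
    contains the generators. This is used with [B] a single generator, then with [B] the whole
    algebra. *)
Lemma generated_commutative (A : cstarType R[i]) (I : Type) (u : I -> I -> A) :
  generated_by u -> (forall i j, star (u i j) = u i j) ->
  (forall i j k l, u i j * u k l = u k l * u i j) -> commutative_cstar A.
Proof.
move=> gen su cu.
have ind (B : set A) : (forall i j b, B b -> u i j * b = b * u i j) ->
    (forall b, B b -> B (star b)) -> forall a b, B b -> a * b = b * a.
  move=> Bu Bstar a; pose S := [set a : A | forall b, B b -> a * b = b * a].
  suff SE : S = setT by have : S a by rewrite SE.
  apply: gen => //=.
  - rewrite (_ : S = \bigcap_(b in B) [set a : A | a * b = b * a]) //.
    by apply: closed_bigI => b _; exact: closed_commutant.
  - by move=> b _; rewrite mul1r mulr1.
  - by move=> x y hx hy b Bb; rewrite mulrDl mulrDr hx // hy.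
  - by move=> c x hx b Bb; rewrite cscale_mull cscale_mulr hx.
  - by move=> x y hx hy b Bb; rewrite -mulrA hy // mulrA hx // mulrA.
  - move=> x hx b Bb; rewrite -[b]starK -!starM hx //; exact: Bstar.
have cgen a k l : a * u k l = u k l * a.
  apply: (ind [set u k l]) => // [i j _ ->|_ ->]; [exact: cu|exact: su].
by move=> a b; apply: (ind setT).
Qed.

End ClassicalSymmetry.

(** * The C*-algebra of matrices *)

Section NumDomain.
Variables (F : numDomainType).
Implicit Types a b c x y z : F.

Lemma le_mul_trans a b x y z : 0 <= b -> y <= a * x -> z <= b * y -> z <= a * b * x.
Proof.
move=> b0 yx zy; rewrite (le_trans zy) // [a * b]mulrC -mulrA.
by rewrite ler_wpM2l.
Qed.

(** Meant, like [le_sqrtC_mul], for [x], [y], [z] the norms of [v], [v A*], [v A* A]. The former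
    yields that [A*] has at most the norm of [A], the latter the hard half of the C*-identity. *)
Lemma le_sqr_cancel c x y z :
  0 <= c -> 0 <= x -> 0 <= y -> y ^+ 2 <= z * x -> z <= c * y -> y <= c * x.
Proof.
move=> c0 x0 y0 yzx zcy.
have [->|yN0] := eqVneq y 0; first by rewrite mulr_ge0.
have yp : 0 < y by rewrite lt_def yN0 y0.
rewrite -(ler_pM2r yp) -expr2 (le_trans yzx) // mulrAC.
by rewrite ler_wpM2r.
Qed.

End NumDomain.

Lemma le_sqrtC_mul (C : numClosedFieldType) (a x y z : C) :
  0 <= a -> 0 <= x -> 0 <= y -> y ^+ 2 <= z * x -> z <= a * x -> y <= sqrtC a * x.
Proof.
move=> a0 x0 y0 yzx zax.
rewrite -(@ler_pXn2r _ 2) ?nnegrE ?mulr_ge0 ?sqrtC_ge0 //.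
by rewrite exprMn sqrtCK (le_trans yzx) // [x ^+ 2]expr2 mulrA ler_wpM2r.
Qed.

Lemma sqr_le_sqrtC (C : numClosedFieldType) (a x : C) :
  0 <= a -> 0 <= x -> x <= sqrtC a -> x ^+ 2 <= a.
Proof.
by move=> a0 x0 xa; rewrite -[a]sqrtCK ler_pXn2r ?nnegrE ?sqrtC_ge0.
Qed.

(** * The Hilbert norm of row vectors and the adjoint *)

Section HilbertNorm.
Variables (C : numClosedFieldType) (n : nat).
Implicit Types (u v : 'rV[C]_n) (A B : 'M[C]_n).

Definition hnorm v : C := sqrtC (dotmx v v).

Lemma hnorm_ge0 v : 0 <= hnorm v.
Proof. by rewrite sqrtC_ge0 dnorm_ge0. Qed.

Lemma hnormZ (c : C) v : hnorm (c *: v) = `|c| * hnorm v.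
Proof.
by rewrite /hnorm dnormZ sqrtCM ?nnegrE ?dnorm_ge0 ?exprn_ge0 // sqrCK.
Qed.

Lemma hnorm_eq0 v : (hnorm v == 0) = (v == 0).
Proof. by rewrite sqrtC_eq0 dnorm_eq0. Qed.

Lemma hnorm0 : hnorm 0 = 0.
Proof. by apply/eqP; rewrite hnorm_eq0. Qed.

Lemma hnorm_triangle u v : hnorm (u + v) <= hnorm u + hnorm v.
Proof. exact: triangle_lerif. Qed.

Lemma hnorm_sum (I : finType) (F : I -> 'rV[C]_n) :
  hnorm (\sum_i F i) <= \sum_i hnorm (F i).
Proof.
apply: (big_ind2 (fun a b => hnorm a <= b)) => //.
  by rewrite hnorm0.
by move=> a b c d ab cd; rewrite (le_trans (hnorm_triangle _ _)) // lerD.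
Qed.

Lemma hnorm_delta i : hnorm (delta_mx 0 i) = 1.
Proof.
rewrite /hnorm dotmxE mxE (bigD1 i) //= big1 => [|j ji]; last first.
  by rewrite !mxE (negbTE ji) mul0r.
by rewrite !mxE !eqxx conjC1 mulr1 addr0 sqrtC1.
Qed.

Lemma coord_le_hnorm v i : `|v 0 i| <= hnorm v.
Proof.
rewrite -(@ler_pXn2r _ 2) ?nnegrE ?hnorm_ge0 // sqrtCK dotmxE mxE.
rewrite (bigD1 i) //= !mxE -normCK lerDl sumr_ge0 // => j _.
by rewrite !mxE mul_conjC_ge0.
Qed.

Lemma hnorm_le_coord v : hnorm v <= \sum_i `|v 0 i|.
Proof.
rewrite {1}(row_sum_delta v) (le_trans (hnorm_sum _)) //.
by apply: ler_sum => i _; rewrite hnormZ hnorm_delta mulr1.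
Qed.

Lemma hnorm_mulmx_bound A v :
  hnorm (v *m A) <= (\sum_i hnorm (row i A)) * hnorm v.
Proof.
rewrite mulmx_sum_row (le_trans (hnorm_sum _)) // mulr_suml.
apply: ler_sum => i _.
by rewrite hnormZ mulrC ler_wpM2l ?hnorm_ge0 // coord_le_hnorm.
Qed.

Definition adjoint A : 'M[C]_n := map_mx Num.conj A^T.

Lemma adjointK : involutive adjoint.
Proof. by move=> A; rewrite /adjoint map_trmx trmxK map_mxCK. Qed.

Lemma adjointD A B : adjoint (A + B) = adjoint A + adjoint B.
Proof. by rewrite /adjoint raddfD /= map_mxD. Qed.

Lemma adjointZ (c : C) A : adjoint (c *: A) = c^* *: adjoint A.
Proof. by rewrite /adjoint linearZ /= map_mxZ. Qed.

Lemma adjointM A B : adjoint (A *m B) = adjoint B *m adjoint A.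
Proof. by rewrite /adjoint trmx_mul map_mxM. Qed.

Lemma dotmx_adjoint A u v : dotmx (u *m A) v = dotmx u (v *m adjoint A).
Proof.
rewrite !dotmxE; congr (_ 0 0).
by rewrite trmx_mul map_mxM map_trmx trmxK map_mxCK mulmxA.
Qed.

(** Cauchy-Schwarz for [v A* A] and [v], whose inner product is the squared norm of [v A*]. *)
Lemma hnorm_adjoint A v :
  hnorm (v *m adjoint A) ^+ 2 <= hnorm (v *m (adjoint A *m A)) * hnorm v.
Proof.
rewrite [hnorm _ ^+ 2]sqrtCK mulmxA -dotmx_adjoint.
have dot0 : 0 <= dotmx (v *m adjoint A *m A) v.
  by rewrite dotmx_adjoint dnorm_ge0.
have [+ _] := CauchySchwarz_sqrt (@dotmx C n) (v *m adjoint A *m A) v.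
by rewrite ger0_norm.
Qed.

End HilbertNorm.

(** * Operator norm and C*-structure on square matrices *)

Section MatrixCStar.
Variables (R : realType) (n : nat).
Local Notation C := R[i].

Definition cmx := 'M[C]_n.
HB.instance Definition _ := GRing.Lmodule.copy cmx 'M[C]_n.
Implicit Types (A B : cmx) (v : 'rV[C]_n).

Definition opnorm A : C :=
  (sup [set r | exists2 v, hnorm v <= 1 & r = complex.Re (hnorm (v *m A))])%:C%C.

Lemma hnorm_mulmx A v : hnorm (v *m A) <= opnorm A * hnorm v.
Proof.
have unit w : hnorm w <= 1 -> hnorm (w *m A) <= opnorm A.
  move=> w1; rewrite [leLHS]norm_Re ?hnorm_ge0 // lecR.
  apply: ub_le_sup; last by exists w.
  exists (complex.Re (\sum_i hnorm (row i A))) => _ [x x1 ->]; apply: Re_le.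
  rewrite (le_trans (hnorm_mulmx_bound _ _)) // ler_piMr //.
  by apply: sumr_ge0 => i _; exact: hnorm_ge0.
have [->|v0] := eqVneq v 0; first by rewrite mul0mx hnorm0 mulr0.
have vp : 0 < hnorm v by rewrite lt_def hnorm_eq0 v0 hnorm_ge0.
have := unit ((hnorm v)^-1 *: v).
rewrite -scalemxAl !hnormZ ger0_norm ?invr_ge0 ?hnorm_ge0 //.
by rewrite mulVf ?gt_eqF // mulrC ler_pdivrMr // => /(_ (lexx _)).
Qed.

Lemma opnorm_le A (K : C) :
  0 <= K -> (forall v, hnorm (v *m A) <= K * hnorm v) -> opnorm A <= K.
Proof.
move=> K0 HK; rewrite [leRHS]norm_Re // lecR; apply: ge_sup.
  by exists (complex.Re (hnorm (0 *m A))), 0; rewrite ?hnorm0.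
move=> _ [v v1 ->]; apply: Re_le; rewrite (le_trans (HK v)) //.
by rewrite ler_piMr.
Qed.

Lemma opnorm_ge0 A : 0 <= opnorm A.
Proof.
rewrite lecR; have [|no] := pselect (has_ubound
  [set r | exists2 v, hnorm v <= 1 & r = complex.Re (hnorm (v *m A))]).
  by move=> ub; apply: ub_le_sup => //; exists 0; rewrite ?mul0mx hnorm0.
(* An unbounded set has supremum 0 by convention. *)
by rewrite sup_out // => -[].
Qed.

Lemma opnormD A B : opnorm (A + B) <= opnorm A + opnorm B.
Proof.
apply: opnorm_le => [|v]; first by rewrite addr_ge0 // opnorm_ge0.
rewrite mulmxDr (le_trans (hnorm_triangle _ _)) // mulrDl lerD //;
exact: hnorm_mulmx.
Qed.

Lemma opnormZ_le (c : C) A : opnorm (c *: A) <= `|c| * opnorm A.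
Proof.
apply: opnorm_le => [|v]; first by rewrite mulr_ge0 // opnorm_ge0.
by rewrite -scalemxAr hnormZ -mulrA ler_wpM2l // hnorm_mulmx.
Qed.

Lemma opnormZ (c : C) A : opnorm (c *: A) = `|c| * opnorm A.
Proof.
apply/eqP; rewrite eq_le opnormZ_le /=.
have [->|c0] := eqVneq c 0; first by rewrite normr0 mul0r opnorm_ge0.
have cp : 0 < `|c| by rewrite normr_gt0.
have := opnormZ_le c^-1 (c *: A).
by rewrite scalerA mulVf // scale1r normfV ler_pdivlMl.
Qed.

Lemma entry_le_opnorm A i j : `|A i j| <= opnorm A.
Proof.
have := hnorm_mulmx A (delta_mx 0 i); rewrite hnorm_delta mulr1 -rowE.
by apply: le_trans; have := coord_le_hnorm (row i A) j; rewrite mxE.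
Qed.

Lemma opnorm_le_entries A : opnorm A <= \sum_i \sum_j `|A i j|.
Proof.
apply: opnorm_le => [|v]; first by do 2 (apply: sumr_ge0 => ? _).
rewrite (le_trans (hnorm_mulmx_bound _ _)) // ler_wpM2r ?hnorm_ge0 //.
apply: ler_sum => i _; rewrite (le_trans (hnorm_le_coord _)) //.
by apply: ler_sum => j _; rewrite mxE.
Qed.

Lemma opnorm0_eq0 A : opnorm A = 0 -> A = 0.
Proof.
move=> A0; apply/matrixP => i j; rewrite mxE; apply/eqP.
by rewrite -normr_eq0 eq_le normr_ge0 andbT -A0 entry_le_opnorm.
Qed.

HB.instance Definition _ :=
  Lmodule_isNormed.Build C cmx opnormD opnormZ opnorm0_eq0.

(** The limit is entrywise: real and imaginary parts of entries are 1-Lipschitz for the operator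
    norm, which the sum of the moduli of the entries bounds from above. *)
Lemma cmx_complete (F : set_system cmx) : ProperFilter F -> cauchy F -> cvg F.
Proof.
move=> FF /cauchy_ballP cF.
have near_pt (e : C) : 0 < e -> exists A : cmx, F [set B | `|B - A| <= e].
  move=> e0; have /cauchyP/(_ e e0)[A FA] : cauchy F by exact/cauchy_ballP.
  exists A; apply: filterS FA => B; rewrite -ball_normE /= distrC; exact: ltW.
have key (phi : cmx -> R) :
    (forall A B (e : R), `|A - B| <= e%:C%C -> `|phi A - phi B| <= e) ->
    exists l : R, forall (e : R) A, 0 < e -> F [set B | `|B - A| <= e%:C%C] ->
      `|l - phi A| <= e + e.
  move=> lip; have cphi : cvg (phi @ F).
    apply: cauchy_cvg; apply: cauchy_exP => e e0.
    have e2 : 0 < (e / 2)%:C%C by rewrite ltcR divr_gt0.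
    have [A FA] := near_pt _ e2; exists (phi A).
    change (F [set B | ball (phi A) e (phi B)]).
    apply: filterS FA => B /= AB; rewrite -ball_normE /= distrC.
    by rewrite (le_lt_trans (lip _ _ _ AB)) // ltr_pdivrMr // mulr_natr mulr2n ltrDl.
  exists (lim (phi @ F)) => e A e0 FA.
  have /cvgrPdist_le/(_ e e0) Fe := cphi.
  have [B [/= AB lB]] := filter_ex (filterI FA Fe).
  by rewrite -(subrKA (phi B)) (le_trans (ler_normD _ _)) // lerD // lip.
have Re_norm (z : C) : `|complex.Re z|%:C%C <= `|z|.
  by rewrite normc_def lecR -sqrtr_sqr ler_wsqrtr // lerDl sqr_ge0.
have Im_norm (z : C) : `|complex.Im z|%:C%C <= `|z|.
  by rewrite normc_def lecR -sqrtr_sqr ler_wsqrtr // lerDr sqr_ge0.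
have entry A B (e : R) i j : `|A - B| <= e%:C%C -> `|A i j - B i j| <= e%:C%C.
  by apply: le_trans; have := entry_le_opnorm (A - B) i j; rewrite !mxE.
have ReB (a b : C) : complex.Re (a - b) = complex.Re a - complex.Re b.
  by case: a b => [? ?] [? ?].
have ImB (a b : C) : complex.Im (a - b) = complex.Im a - complex.Im b.
  by case: a b => [? ?] [? ?].
have norm_ReIm (z : C) :
    `|z| <= (`|complex.Re z| + `|complex.Im z|)%:C%C.
  rewrite normc_def lecR -[leRHS]ger0_norm ?addr_ge0 // -sqrtr_sqr ler_wsqrtr //.
  by rewrite sqrrD !real_normK ?num_real // addrAC lerDl mulrn_wge0 // mulr_ge0.
have /choice[re reP] (ij : 'I_n * 'I_n) :=
  key (fun A => complex.Re (A ij.1 ij.2)) (fun A B e AB =>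
    ltac:(by rewrite -ReB -lecR (le_trans (Re_norm _)) // entry)).
have /choice[im imP] (ij : 'I_n * 'I_n) :=
  key (fun A => complex.Im (A ij.1 ij.2)) (fun A B e AB =>
    ltac:(by rewrite -ImB -lecR (le_trans (Im_norm _)) // entry)).
pose L : cmx := \matrix_(i, j) (re (i, j) +i* im (i, j))%C.
(* Each of the [n * n] entries contributes [2 * d] for its real part and [2 * d] for its imaginary
   part. *)
have L_close (d : R) A : 0 < d -> F [set B | `|B - A| <= d%:C%C] ->
    `|L - A| <= ((n * n)%:R * (4 * d))%:C%C.
  move=> d0 FA; apply: (le_trans (opnorm_le_entries (L - A))).
  have -> : ((n * n)%:R * (4 * d))%:C%C = \sum_(i < n) \sum_(j < n) (4 * d)%:C%C.
    by rewrite !sumr_const !card_ord -mulrnA -rmorphMn /= mulr_natl.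
  apply: ler_sum => i _; apply: ler_sum => j _.
  rewrite (le_trans (norm_ReIm _)) // lecR !mxE ReB ImB /=.
  by have := reP (i, j) d A d0 FA; have := imP (i, j) d A d0 FA => /=; lra.
apply/cvg_ex; exists L; apply/cvgrPdist_le => e e0.
(* The summand 1 accounts for the distance from [A] to [B], the rest for that from [L] to [A]. *)
pose K : R := (n * n)%:R * 4 + 1.
have K0 : 0 < K by rewrite ltr_wpDl // mulr_ge0.
have eE : e = (complex.Re e)%:C%C by apply: norm_Re; exact: ltW.
have d0 : 0 < complex.Re e / K by rewrite divr_gt0 // -ltcR -eE.
have d0C : 0 < (complex.Re e / K)%:C%C by rewrite ltcR.
have [A FA] := near_pt _ d0C; apply: (filterS _ FA) => B /= AB.
rewrite -(subrKA A) (le_trans (ler_normD _ _)) //.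
apply: (@le_trans _ _ (((n * n)%:R * (4 * (complex.Re e / K)))%:C%C
    + (complex.Re e / K)%:C%C)).
  by apply: lerD; [exact: L_close|rewrite distrC].
rewrite -rmorphD [leRHS]eE lecR /= mulrA -[X in _ + X]mul1r -mulrDl -/K mulrC divfK //.
by rewrite gt_eqF.
Qed.

HB.instance Definition _ := Uniform_isComplete.Build cmx cmx_complete.

Lemma opnormM A B : opnorm (A *m B) <= opnorm A * opnorm B.
Proof.
apply: opnorm_le => [|v]; first exact: mulr_ge0 (opnorm_ge0 A) (opnorm_ge0 B).
rewrite mulmxA.
exact: le_mul_trans (opnorm_ge0 B) (hnorm_mulmx A v) (hnorm_mulmx B (v *m A)).
Qed.

Lemma opnorm_adjoint_le A : opnorm (adjoint A) <= opnorm A.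
Proof.
apply: opnorm_le => [|v]; first exact: opnorm_ge0.
apply: (le_sqr_cancel (opnorm_ge0 A) (hnorm_ge0 v) (hnorm_ge0 _) (hnorm_adjoint A v)).
by rewrite mulmxA; exact: hnorm_mulmx.
Qed.

Lemma opnorm_adjoint A : opnorm (adjoint A) = opnorm A.
Proof.
have le1 := opnorm_adjoint_le A; have := opnorm_adjoint_le (adjoint A).
by rewrite adjointK => le2; exact: le_anti (introT andP (conj le1 le2)).
Qed.

(** Submultiplicativity gives one half; for the other, [hnorm_adjoint] bounds the norm of the
    adjoint by a square root. *)
Lemma opnorm_adjointM A : opnorm (adjoint A *m A) = opnorm A ^+ 2.
Proof.
apply: le_anti; apply/andP; split.
  by have := opnormM (adjoint A) A; rewrite opnorm_adjoint expr2.
have s0 := opnorm_ge0 (adjoint A *m A).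
rewrite -opnorm_adjoint; apply: (sqr_le_sqrtC s0 (opnorm_ge0 _)).
apply: opnorm_le => [|v]; first by rewrite sqrtC_ge0.
exact: le_sqrtC_mul s0 (hnorm_ge0 v) (hnorm_ge0 _) (hnorm_adjoint A v) (hnorm_mulmx _ v).
Qed.

HB.instance Definition _ := isCStarAlgebra.Build C cmx
  (@mulmxA _ _ _ _ _) (@mul1mx _ _ _) (@mulmx1 _ _ _) (@mulmxDl _ _ _ _) (@mulmxDr _ _ _ _)
  (@scalemxAl _ _ _ _) (@scalemxAr _ _ _ _)
  (@adjointD C n) (@adjointZ C n) (@adjointM C n) (@adjointK C n)
  opnormM opnorm_adjointM.

End MatrixCStar.

Lemma noncommuting_projections (R : realType) :
  exists (A : cstarType R[i]) (p q : A),
    [/\ projection p, projection q & p * q <> q * p].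
Proof.
(* The projections onto the lines of [(1, 0)] and [(1, 1)]; entry [(0, 1)] is 1/2 in one product and
   0 in the other. *)
exists (cmx R 2 : cstarType R[i]), (delta_mx 0 0), (const_mx 2^-1); split.
- split; last by rewrite [LHS]mul_delta_mx.
  by rewrite [LHS]/star /= /adjoint trmx_delta map_delta_mx.
- split.
    rewrite [LHS]/star /= /adjoint trmx_const map_const_mx /=.
    by rewrite (CrealP _) // rpredV realn.
  apply/matrixP => i j; rewrite !mxE big_ord_recl big_ord1 !mxE.
  by field.
- move=> /matrixP/(_ 0 1); rewrite !mxE !big_ord_recl !big_ord0 !mxE /=.
  by rewrite !(mul1r, mul0r, mulr0, addr0) => /eqP; rewrite invr_eq0 pnatr_eq0.
Qed.

(** * Quantum automorphisms built from two classical ones *)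

Section MixedAutomorphisms.
Variables (R : realType) (A : cstarType R[i]) (G : sgraph).
Implicit Types (p : A) (f : {perm G}) (u v : G -> G -> A).

Let mul_boolC (a : A) (b : bool) : a * b%:R = b%:R * a.
Proof. by case: b; rewrite ?mulr1 ?mul1r ?mulr0 ?mul0r. Qed.

Let sum_eq (F : G -> A) x : \sum_y F y * (x == y)%:R = F x.
Proof.
rewrite (bigD1 x) //= eqxx mulr1 big1 ?addr0 // => y yx.
by rewrite eq_sym (negbTE yx) mulr0.
Qed.

Let perm_eqE f x y : (f x == y) = (f^-1%g y == x).
Proof. by rewrite eq_sym -[RHS](inj_eq (@perm_inj _ f)) permKV. Qed.

(* Unlike [quantum_automorphism], stable under matrix products. *)
Definition weak_quantum_automorphism u :=
  [/\ forall x, \sum_y u x y = 1, forall x, \sum_y u y x = 1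
    & forall x y, \sum_z u x z * (edge z y)%:R = \sum_z (edge x z)%:R * u z y].

Definition mix p f x y : A := p * (f x == y)%:R + (1 - p) * (x == y)%:R.

Lemma mix_weak p f : automorphism f -> weak_quantum_automorphism (mix p f).
Proof.
move=> fa; split=> [x|x|x y].
- by rewrite big_split /= !sum_eq addrC subrK.
- rewrite big_split /=; under eq_bigr do rewrite perm_eqE.
  by under [X in _ + X]eq_bigr do rewrite eq_sym; rewrite !sum_eq addrC subrK.
(* The sums collapse to [edge (f x) y] and [edge x (f^-1 y)], which agree since [f] is an
   automorphism. *)
- transitivity (p * (edge (f x) y)%:R + (1 - p) * (edge x y)%:R).
    rewrite -(sum_eq (fun z => p * (edge z y)%:R)).
    rewrite -(sum_eq (fun z => (1 - p) * (edge z y)%:R)) -big_split.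
    by apply: eq_bigr => z _; rewrite /= /mix mulrDl -!mulrA !(mul_boolC (edge z y)%:R).
  have -> : edge (f x) y = edge x (f^-1%g y) by rewrite -(fa x) permKV.
  rewrite -(sum_eq (fun z => p * (edge x z)%:R)).
  rewrite -(sum_eq (fun z => (1 - p) * (edge x z)%:R)) -big_split.
  apply: eq_bigr => z _; rewrite /= -mul_boolC /mix [in RHS]mulrDl -!mulrA.
  by rewrite !(mul_boolC (edge x z)%:R) (perm_eqE f) (eq_sym y).
Qed.

Lemma weak_mul u v : weak_quantum_automorphism u -> weak_quantum_automorphism v ->
  weak_quantum_automorphism (fun x y => \sum_z u x z * v z y).
Proof.
move=> [ur uc ua] [vr vc va]; split=> [x|x|x y].
- rewrite exchange_big /= -[RHS](ur x); apply: eq_bigr => z _.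
  by rewrite -mulr_sumr vr mulr1.
- rewrite exchange_big /= -[RHS](vc x); apply: eq_bigr => z _.
  by rewrite -mulr_suml uc mul1r.
- transitivity (\sum_t u x t * \sum_z v t z * (edge z y)%:R).
    under eq_bigr do rewrite mulr_suml.
    rewrite exchange_big; apply: eq_bigr => t _.
    by rewrite mulr_sumr; apply: eq_bigr => z _; rewrite mulrA.
  transitivity (\sum_t (\sum_z u x z * (edge z t)%:R) * v t y).
    under eq_bigr do rewrite va mulr_sumr.
    under [RHS]eq_bigr do rewrite mulr_suml.
    rewrite exchange_big; apply: eq_bigr => t _.
    by apply: eq_bigr => z _; rewrite mulrA.
  under eq_bigr do rewrite ua mulr_suml.
  under [RHS]eq_bigr do rewrite mulr_sumr.
  rewrite exchange_big; apply: eq_bigr => t _.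
  by apply: eq_bigr => z _; rewrite mulrA.
Qed.

Lemma projection_mix p f x y : projection p -> projection (mix p f x y).
Proof.
move=> [sp pp]; rewrite /mix; have [spC ppC] := projectionC (conj sp pp).
case: (f x == y); case: (x == y); rewrite ?mulr1 ?mulr0 ?addr0 ?add0r //.
- by rewrite addrC subrK; split; rewrite ?star1 ?mulr1.
- by split; rewrite ?mulr0 // -[X in star X](subrr 1) starD starN subrr.
Qed.

Lemma mix_fixed p f x y : f x = x -> mix p f x y = (x == y)%:R.
Proof. by move=> fx; rewrite /mix fx -mulrDl addrC subrK mul1r. Qed.

Lemma mix_moved p f x : f x != x -> mix p f x (f x) = p.
Proof. by move=> fx; rewrite /mix eqxx eq_sym (negbTE fx) mulr1 mulr0 addr0. Qed.

(** Each row of the product is a row of one factor, so for projections [p] and [q] its entries are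
    projections even when [p] and [q] do not commute. *)
Lemma mix_mul p q f g x y : [disjoint Supp f & Supp g]%B ->
  \sum_z mix p f x z * mix q g z y =
  if f x == x then mix q g x y else mix p f x y.
Proof.
move=> /pred0P fg; have fixg z : f z != z -> g z = z.
  by move=> fz; have := fg z; rewrite /= !inE fz /= => /negbFE/eqP.
have [fx|fx] := eqVneq (f x) x.
  under eq_bigr do rewrite mix_fixed // -mul_boolC.
  exact: sum_eq.
have ffx : f (f x) != f x by rewrite (inj_eq perm_inj).
rewrite -[RHS](sum_eq (fun z => mix p f x z)); apply: eq_bigr => z _.
(* A [z] moved by [g] is fixed by [f], so it is neither [x] nor [f x] and [mix p f x z] vanishes. *)
have [gz|gz] := eqVneq (g z) z; first by rewrite (mix_fixed _ _ gz) (eq_sym y).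
have fz a : f a != a -> (a == z) = false.
  by move=> fa; apply: contraNF gz => /eqP <-; rewrite fixg.
by rewrite /mix (fz _ ffx) (fz _ fx) /= !mulr0 addr0 !mul0r.
Qed.

End MixedAutomorphisms.

Lemma schmidt_noncommuting (R : realType) (A : cstarType R[i]) (p q : A) (G : sgraph) :
  projection p -> projection q -> schmidt_criterion G ->
  exists u : G -> G -> A, quantum_automorphism u /\
    exists x y x' y', u x y = p /\ u x' y' = q.
Proof.
move=> pp qq [f [g [fa ga f1 g1 fg]]].
have [x fx] : exists x, f x != x.
  apply/existsP; apply: contraNT f1 => /existsPn h; apply/eqP/permP => x.
  by rewrite perm1; apply/eqP; rewrite -[_ == _]negbK h.
have [y gy] : exists y, g y != y.
  apply/existsP; apply: contraNT g1 => /existsPn h; apply/eqP/permP => y.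
  by rewrite perm1; apply/eqP; rewrite -[_ == _]negbK h.
have fy : f y = y.
  by have /pred0P/(_ y) := fg; rewrite /= !inE gy andbT => /negbFE/eqP.
exists (fun x y => \sum_z mix p f x z * mix q g z y); split; last first.
  (* Row [x] is moved by [f] and contains [p]; row [y] is fixed by [f] and contains [q]. *)
  exists x, (f x), y, (g y).
  by rewrite !mix_mul // (negbTE fx) fy eqxx !mix_moved.
have [ur uc ua] := weak_mul (mix_weak p fa) (mix_weak q ga).
split=> // a b; rewrite mix_mul //.
by case: eqP => _; exact: projection_mix.
Qed.

(** The universal property sends the generators to a quantum automorphism with non-commuting
    entries. *)
Lemma schmidt_quantum_symmetry (R : realType) (G : sgraph) :
  schmidt_criterion G -> quantum_symmetry R G.
Proof.
move=> sG cG; have [A [p [q [pp qq pq]]]] := noncommuting_projections R.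
have [u [qu [x [y [x' [y' [up uq]]]]]]] := schmidt_noncommuting pp qq sG.
have [_ _ /(_ _ _ qu)[phi [_ _ phiM _ _] phiu]] := CQu_universal R G.
by apply: pq; rewrite -up -uq -!phiu -!phiM cG.
Qed.

Theorem theorem4p6 (R : realType) (G : sgraph) (cographG : cograph G) :
  let n := #|G| in
  [<-> ~ quantum_symmetry R G;
       ~ schmidt_criterion G;
       isomorphic G K1 \/
       isomorphic G (X_graph n) \/ isomorphic G (complement (X_graph n)) \/
       (2 <= n)%N /\
       (isomorphic G (Y_graph n) \/ isomorphic G (complement (Y_graph n)))].
Proof.
move=> n; tfae.
- by move=> nQ sG; apply: nQ; exact: schmidt_quantum_symmetry.
- move=> /(not_schmidt_in_XY cographG)[m Gm].
  rewrite /n (in_XY_card Gm) ltnS.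
  by case: Gm => [h|h|[m0 h]|[m0 h]]; tauto.
- move=> G_XY; have [m Gm] : exists m, in_XY m G.
    have nE : n = n.-1.+1 by rewrite prednK // vertex_gt0.
    move: G_XY; rewrite nE ltnS.
    move=> [/isomorphic_card GK1|[h|[h|[n1 [h|h]]]]].
    + by exists 0%N; apply: in_XY_K1; rewrite GK1 card_K1.
    + by exists n.-1; constructor 1.
    + by exists n.-1; constructor 2.
    + by exists n.-1; constructor 3.
    + by exists n.-1; constructor 4.
  have cG : classical_symmetry R G := classical_in_XY Gm.
  (* Classical symmetry is applied to the universal quantum automorphism, whose entries generate the
     algebra. *)
  have [qu gen _] := CQu_universal R G.
  apply; apply: (generated_commutative gen) => [x y|x y x' y'].
    by have [/(_ x y)[]] := qu.
  exact: cG qu _ _ _ _.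
Qed.
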